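(* Let $n\ge1$, $\delta>0$ and $\beta<n+2$. Let $\mathbf f\in\mathcal H^{s_1}(\mathbf T^n)$ and $\mathbf g\in\mathcal H^{s_2}(\mathbf T^n)$ with $s_1,s_2\in\mathbb{R}$, let $s=\min\{s_1,s_2+\max\{0,\frac{\beta-n}{2}\}\}$, and for $t\ge0$ define $$\mathbf U(t)=(\widehat{\mathbf f}_0+\widehat{\mathbf g}_0t)+\sum_{0\ne k\in\mathbb{Z}^n}\left(\cos(\sqrt{-M_k}\,t)\widehat{\mathbf f}_k+\sin(\sqrt{-M_k}\,t)(\sqrt{-M_k})^{-1}\widehat{\mathbf g}_k\right)e^{ik\cdot x}.$$ Then: 1. if $\beta<n$, then $\mathbf U\in C^\infty([0,\infty),\mathcal H^q(\mathbf T^n))$ for any $q\le s$; 2. if $\beta=n$, then $\mathbf U\in C^\infty([0,\infty),\mathcal H^q(\mathbf T^n))$ for any $q<s$; 3. if $\beta>n$, then $\mathbf U\in C^{p+1}([0,\infty),\mathcal H^q(\mathbf T^n))$ for any $q\in\mathbb{R}$ and any positive integer $p$ satisfying $$q-s_1+(p+1)\frac{\beta-n}{2}\le0\quad\text{and}\quad q-s_2+p\,\frac{\beta-n}{2}\le0.$$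
   Context: Torus and spaces: $\mathbf T^n=\prod_{i=1}^n[0,2\pi]$ with periodic identification; a periodic vector distribution $\mathbf g$ is written $\mathbf g=\sum_{k\in\mathbb{Z}^n}\widehat{\mathbf g}_k e^{ik\cdot x}$ with Fourier coefficients $\widehat{\mathbf g}_k\in\mathbb{C}^n$. For $q\in\mathbb{R}$, $\mathcal H^q(\mathbf T^n)$ is the space of periodic vector distributions with $\|\mathbf g\|^2_{\mathcal H^q}=\sum_k(1+\|k\|^2)^q\|\widehat{\mathbf g}_k\|^2<\infty$. The derivative of a map $\mathbf U:[0,\infty)\to\mathcal H^q(\mathbf T^n)$ is $\mathbf U'(t)=\lim_{h\to0}\frac{\mathbf U(t+h)-\mathbf U(t)}{h}$, the limit taken in the $\mathcal H^q$ norm (one-sided at $t=0$). $C^p([0,\infty),\mathcal H^q(\mathbf T^n))$ denotes the maps $[0,\infty)\to\mathcal H^q(\mathbf T^n)$ that are $p$ times differentiable in this sense; $C^\infty$ means this for every $p$. Multipliers: with ${}_pF_q(a_1,\dots,a_p;b_1,\dots,b_q;x)=\sum_{m\ge0}\frac{(a_1)_m\cdots(a_p)_m}{(b_1)_m\cdots(b_q)_m}\frac{x^m}{m!}$, where $(a)_m=a(a+1)\cdots(a+m-1)$, set for $\nu\in\mathbb{R}^n$ $$\lambda_1(\nu)=-\|\nu\|^2\Big(3\mu\,{}_3F_4\big(1,\tfrac52,\tfrac{n+2-\beta}{2};2,\tfrac32,\tfrac{n+4}{2},\tfrac{n+4-\beta}{2};-\tfrac14\|\nu\|^2\delta^2\big)+(\lambda^*-\mu)\,{}_1F_2\big(\tfrac{n+2-\beta}{2};\tfrac{n+2}{2},\tfrac{n+4-\beta}{2};-\tfrac14\|\nu\|^2\delta^2\big)^2\Big),$$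 $$\lambda_2(\nu)=-\mu\|\nu\|^2\,{}_2F_3\big(1,\tfrac{n+2-\beta}{2};2,\tfrac{n+4}{2},\tfrac{n+4-\beta}{2};-\tfrac14\|\nu\|^2\delta^2\big).$$ For $k\in\mathbb{Z}^n\setminus\{0\}$, $M_k$ is the real symmetric $n\times n$ matrix with $M_kk=\lambda_1(k)k$ and $M_kw=\lambda_2(k)w$ for $w\perp k$ (the Fourier multiplier of the linear state-based peridynamic operator). $\sqrt{-M_k}$, $\cos(\sqrt{-M_k}t)$, $\sin(\sqrt{-M_k}t)$ are defined by functional calculus: same eigenvectors, with eigenvalues $\sqrt{-\lambda_i(k)}$, $\cos(\sqrt{-\lambda_i(k)}t)$, $\sin(\sqrt{-\lambda_i(k)}t)$. Standing assumption: the Lamé parameters satisfy $\mu>0$ and $\lambda^*\in\mathbb{R}$ is such that $\lambda_1(\nu)<0$ for all $\nu\ne0$ (and $\lambda_2(\nu)<0$ for all $\nu\neq0$). *)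

(* Defs.v *)
From HB Require Import structures.
From mathcomp Require Import all_boot all_order all_algebra.
From mathcomp Require Import complex.
From mathcomp Require Import all_classical all_reals all_analysis.

Set Implicit Arguments.
Unset Strict Implicit.
Unset Printing Implicit Defensive.

Import Order.TTheory GRing.Theory Num.Theory.
Import numFieldNormedType.Exports.

Local Open Scope classical_set_scope.
Local Open Scope ring_scope.
Local Open Scope complex_scope.

Definition pochhammer (R : realType) (a : R) (m : nat) : R :=
  \prod_(i < m) (a + i%:R).

(* [hypergeom [:: a_1; ..; a_p] [:: b_1; ..; b_q] x] is pFq(a; b; x). *)
Definition hypergeom (R : realType) (a b : seq R) (x : R) : R :=
  limn (series (fun m : nat =>
    (\prod_(c <- a) pochhammer c m) / (\prod_(c <- b) pochhammer c m)
    * (x ^+ m / m`!%:R))).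

(* The norms here are Euclidean, whereas the library norm [`|_|] on matrices
   is the sup norm. *)
Definition sqnorm (R : realType) (n : nat) (v : 'cV[R]_n) : R :=
  \sum_(i < n) v i 0 ^+ 2.

Definition sqnormC (R : realType) (n : nat) (v : 'cV[R[i]]_n) : R :=
  \sum_(i < n) (complex.Re (v i 0) ^+ 2 + complex.Im (v i 0) ^+ 2).

Definition int_vec (R : realType) (n : nat) (k : 'cV[int]_n) : 'cV[R]_n :=
  map_mx (fun z : int => z%:~R) k.
Arguments int_vec R {n} k.

Definition lambda1 (R : realType) (n : nat) (delta beta mu lam : R)
    (nu : 'cV[R]_n) : R :=
  let x := - (1 / 4) * sqnorm nu * delta ^+ 2 in
  - sqnorm nu *
  (3 * mu * hypergeom [:: 1; 5 / 2; (n%:R + 2 - beta) / 2]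
              [:: 2; 3 / 2; (n%:R + 4) / 2; (n%:R + 4 - beta) / 2] x
   + (lam - mu) * hypergeom [:: (n%:R + 2 - beta) / 2]
              [:: (n%:R + 2) / 2; (n%:R + 4 - beta) / 2] x ^+ 2).

Definition lambda2 (R : realType) (n : nat) (delta beta mu : R)
    (nu : 'cV[R]_n) : R :=
  let x := - (1 / 4) * sqnorm nu * delta ^+ 2 in
  - mu * sqnorm nu *
  hypergeom [:: 1; (n%:R + 2 - beta) / 2]
    [:: 2; (n%:R + 4) / 2; (n%:R + 4 - beta) / 2] x.

Definition line_proj (R : realType) (n : nat) (v : 'cV[R]_n) : 'M[R]_n :=
  (sqnorm v)^-1 *: (v *m v^T).

(* For [v != 0], the symmetric matrix acting as [a] on the line of [v] and as
   [b] on its orthogonal complement; see [two_eigen_mx_line],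
   [two_eigen_mx_orth] and [two_eigen_mx_unique]. *)
Definition two_eigen_mx (R : realType) (n : nat) (v : 'cV[R]_n) (a b : R) :
    'M[R]_n :=
  a *: line_proj v + b *: (1%:M - line_proj v).

Definition multiplier (R : realType) (n : nat) (delta beta mu lam : R)
    (k : 'cV[int]_n) : 'M[R]_n :=
  two_eigen_mx (int_vec R k) (lambda1 delta beta mu lam (int_vec R k))
                             (lambda2 delta beta mu (int_vec R k)).

(* Functional calculus: phi(M_k), where M_k is [multiplier]. *)
Definition multiplier_fun (R : realType) (n : nat) (delta beta mu lam : R)
    (phi : R -> R) (k : 'cV[int]_n) : 'M[R]_n :=
  two_eigen_mx (int_vec R k) (phi (lambda1 delta beta mu lam (int_vec R k)))
                             (phi (lambda2 delta beta mu (int_vec R k))).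

Lemma sqnormE (R : realType) (n : nat) (v : 'cV[R]_n) :
  v^T *m v = (sqnorm v)%:M.
Proof.
apply/matrixP => i j; rewrite !ord1 !mxE eqxx mulr1n /sqnorm.
by apply: eq_bigr => l _; rewrite mxE expr2.
Qed.

Lemma sqnorm_eq0 (R : realType) (n : nat) (v : 'cV[R]_n) :
  (sqnorm v == 0) = (v == 0).
Proof.
apply/eqP/eqP => [|->]; last by rewrite /sqnorm big1 // => i _; rewrite mxE expr0n.
move=> h; apply/matrixP => i j; rewrite ord1 mxE.
have /psumr_eq0P/(_ h i isT)/eqP : forall l, true -> 0 <= v l 0 ^+ 2.
  by move=> l _; exact: sqr_ge0.
by rewrite sqrf_eq0 => /eqP.
Qed.

Lemma int_vec_neq0 (R : realType) (n : nat) (k : 'cV[int]_n) :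
  k != 0 -> int_vec R k != 0.
Proof.
apply: contraNN => /eqP h; apply/eqP/matrixP => i j.
by move/matrixP/(_ i j)/eqP: h; rewrite !mxE intr_eq0 => /eqP.
Qed.

Lemma line_proj_line (R : realType) (n : nat) (v : 'cV[R]_n) :
  v != 0 -> line_proj v *m v = v.
Proof.
move=> v0; rewrite /line_proj -scalemxAl -mulmxA sqnormE mul_mx_scalar.
by rewrite scalerA mulVf ?scale1r // sqnorm_eq0.
Qed.

Lemma line_proj_orth (R : realType) (n : nat) (v w : 'cV[R]_n) :
  v^T *m w = 0 -> line_proj v *m w = 0.
Proof.
by move=> vw; rewrite /line_proj -scalemxAl -mulmxA vw mulmx0 scaler0.
Qed.

Lemma line_proj_idem (R : realType) (n : nat) (v : 'cV[R]_n) :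
  v != 0 -> line_proj v *m line_proj v = line_proj v.
Proof.
move=> v0; rewrite {2 3}/line_proj -scalemxAr mulmxA.
by rewrite line_proj_line.
Qed.

Lemma two_eigen_mx_sym (R : realType) (n : nat) (v : 'cV[R]_n) (a b : R) :
  (two_eigen_mx v a b)^T = two_eigen_mx v a b.
Proof.
have PT : (line_proj v)^T = line_proj v.
  by rewrite /line_proj linearZ /= trmx_mul trmxK.
rewrite /two_eigen_mx; move: (line_proj v) PT => P PT.
by rewrite raddfD /= !linearZ /= raddfB /= trmx1 PT.
Qed.

Lemma two_eigen_mx_line (R : realType) (n : nat) (v : 'cV[R]_n) (a b : R) :
  v != 0 -> two_eigen_mx v a b *m v = a *: v.
Proof.
move=> /line_proj_line; rewrite /two_eigen_mx; move: (line_proj v) => P Pv.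
by rewrite mulmxDl -!scalemxAl mulmxBl mul1mx Pv subrr scaler0 addr0.
Qed.

Lemma two_eigen_mx_orth (R : realType) (n : nat) (v w : 'cV[R]_n) (a b : R) :
  v^T *m w = 0 -> two_eigen_mx v a b *m w = b *: w.
Proof.
move=> /line_proj_orth; rewrite /two_eigen_mx; move: (line_proj v) => P Pw.
by rewrite mulmxDl -!scalemxAl mulmxBl mul1mx Pw scaler0 subr0 add0r.
Qed.

Lemma two_eigen_mx_unique (R : realType) (n : nat) (v : 'cV[R]_n) (a b : R)
    (A : 'M[R]_n) :
  v != 0 -> A *m v = a *: v ->
  (forall w : 'cV[R]_n, v^T *m w = 0 -> A *m w = b *: w) ->
  A = two_eigen_mx v a b.
Proof.
move=> v0 Av Aw.
have AP : A *m line_proj v = a *: line_proj v.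
  rewrite /line_proj -scalemxAr mulmxA Av -scalemxAl.
  by rewrite !scalerA mulrC.
have AQ : A *m (1%:M - line_proj v) = b *: (1%:M - line_proj v).
  have : v^T *m (1%:M - line_proj v) = 0.
    rewrite mulmxBr mulmx1 /line_proj -scalemxAr mulmxA sqnormE.
    rewrite mul_scalar_mx scalerA mulVf ?sqnorm_eq0 //.
    by rewrite scale1r subrr.
  move: (1%:M - line_proj v) => Q vQ; apply/matrixP => i j.
  have vQj : v^T *m col j Q = 0 by rewrite colE mulmxA vQ mul0mx.
  move/matrixP/(_ i 0): (Aw _ vQj).
  by rewrite colE mulmxA scalemxAl -!colE [LHS]mxE [RHS]mxE.
by rewrite /two_eigen_mx -AP -AQ -mulmxDr addrC subrK mulmx1.
Qed.

(* [multiplier_fun phi] does not depend on how M_k is diagonalized. *)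
Lemma multiplier_fun_eigen (R : realType) (n : nat) (delta beta mu lam : R)
    (phi : R -> R) (k : 'cV[int]_n) (a : R) (v : 'cV[R]_n) :
  k != 0 -> multiplier delta beta mu lam k *m v = a *: v ->
  multiplier_fun delta beta mu lam phi k *m v = phi a *: v.
Proof.
move=> k0; rewrite /multiplier_fun /multiplier.
have : int_vec R k != 0 by exact: int_vec_neq0.
move: (int_vec R k) => x x0.
move: (lambda1 _ _ _ _ _) (lambda2 _ _ _ _) => l1 l2.
move: (line_proj_idem x0); rewrite /two_eigen_mx.
move: (line_proj x) => P PP; rewrite !mulmxDl -!scalemxAl mulmxBl mul1mx.
set p := P *m v; set q := v - p => e.
have Pp : P *m p = p by rewrite /p mulmxA PP.
have Pq : P *m q = 0 by rewrite /q mulmxBr Pp subrr.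
have vE : v = p + q by rewrite /q addrC subrK.
have e1 : l1 *: p = a *: p.
  have := congr1 (mulmx P) e.
  by rewrite mulmxDr -!scalemxAr Pp Pq scaler0 addr0.
have e2 : l2 *: q = a *: q.
  have : l1 *: p + l2 *: q = a *: p + a *: q by rewrite -scalerDr -vE.
  by rewrite e1 => /addrI.
have key (l : R) (w : 'cV[R]_n) : l *: w = a *: w -> phi l *: w = phi a *: w.
  have [->//|la /eqP] := eqVneq l a.
  rewrite -subr_eq0 -scalerBl scaler_eq0 subr_eq0 (negbTE la) /= => /eqP ->.
  by rewrite !scaler0.
by rewrite (key _ _ e1) (key _ _ e2) -scalerDr -vE.
Qed.

(* A periodic vector distribution is represented by its family of Fourier
   coefficients, indexed by Z^n.  No growth condition is imposed here: a family
   of finite H^q norm has polynomial growth, hence is the family of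
   coefficients of a unique periodic distribution. *)
Definition fourier_coefs (R : realType) (n : nat) : Type :=
  'cV[int]_n -> 'cV[R[i]]_n.

Definition sobolev_norm (R : realType) (n : nat) (q : R)
    (g : fourier_coefs R n) : \bar R :=
  sqrte (\esum_(k in [set: 'cV[int]_n])
    ((1 + sqnorm (int_vec R k)) `^ q * sqnormC (g k))%:E).

Definition in_sobolev (R : realType) (n : nat) (q : R)
    (g : fourier_coefs R n) : Prop :=
  (sobolev_norm q g < +oo)%E.

Definition diff_quot (R : realType) (n : nat) (U : R -> fourier_coefs R n)
    (t h : R) : fourier_coefs R n :=
  fun k => (h^-1)%:C *: (U (t + h) k - U t k).

(* [V] is the derivative at [t] of [U] : [0, +oo[ -> H^q; only increments with
   0 <= t + h are used, so that the limit is one-sided at t = 0. *)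
Definition sobolev_deriv (R : realType) (n : nat) (q : R)
    (U : R -> fourier_coefs R n) (t : R) (V : fourier_coefs R n) : Prop :=
  sobolev_norm q (fun k => diff_quot U t h k - V k)
    @[h --> within [set h : R | 0 <= t + h] 0^'] --> 0%E.

(* C^p([0, +oo[, H^q): p times differentiable maps into H^q. Values at
   negative times are irrelevant. *)
Fixpoint sobolev_Cp (R : realType) (n : nat) (p : nat) (q : R)
    (U : R -> fourier_coefs R n) : Prop :=
  (forall t : R, 0 <= t -> in_sobolev q (U t)) /\
  match p with
  | 0%N => True
  | p'.+1 => exists V : R -> fourier_coefs R n,
      (forall t : R, 0 <= t -> sobolev_deriv q U t (V t)) /\
      sobolev_Cp p' q V
  end.

Definition sobolev_Cinfty (R : realType) (n : nat) (q : R)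
    (U : R -> fourier_coefs R n) : Prop :=
  forall p : nat, sobolev_Cp p q U.

Definition complex_mx (R : realType) (n : nat) (A : 'M[R]_n) : 'M[R[i]]_n :=
  map_mx (fun x : R => x%:C) A.

Definition solution (R : realType) (n : nat) (delta beta mu lam : R)
    (f g : fourier_coefs R n) (t : R) : fourier_coefs R n :=
  fun k =>
    if k == 0 then f 0 + t%:C *: g 0 else
    let Mfun := fun phi : R -> R => multiplier_fun delta beta mu lam phi k in
    complex_mx (Mfun (fun l => cos (Num.sqrt (- l) * t))) *m f k
    + complex_mx (Mfun (fun l => sin (Num.sqrt (- l) * t))
                  *m invmx (Mfun (fun l => Num.sqrt (- l)))) *m g k.

(* Main.v *)
Require Import Defs.
From HB Require Import structures.
From mathcomp Require Import all_boot all_order all_algebra.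
From mathcomp Require Import finmap complex.
From mathcomp Require Import all_classical all_reals all_analysis.
From mathcomp Require Import ring lra.

Set Implicit Arguments.
Unset Strict Implicit.
Unset Printing Implicit Defensive.

Import Order.TTheory GRing.Theory Num.Theory.
Import numFieldNormedType.Exports.

Local Open Scope classical_set_scope.
Local Open Scope ring_scope.
Local Open Scope complex_scope.

(** On each frequency k the system is a pair of harmonic oscillators, one along
    k and one orthogonal to it, with angular frequencies
    om_i(k) = sqrt (- lambda_i(k)).  Writing P for the projections onto the
    lines R k and Q = 1 - P,

      U = cos(om_1 t) P f + cos(om_2 t) Q f
          + sin(om_1 t)/om_1 P g + sin(om_2 t)/om_2 Q g,

    the constant mode being the limit om = 0.  Every time derivative costs one
    factor om_i, and the factor 1/om_i in front of g saves one.  So everything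
    follows from an upper bound |lambda_i(k)| <= C (1 + |k|^2)^kappa: the j-th
    derivative, j >= 1, then exists in H^q as soon as q + j kappa <= s1 and
    q + (j - 1) kappa <= s2 ([solution_Cp]).  No lower bound on |lambda_i| is
    involved, since |sin(om t)/om| <= t; and differentiating j times under the
    sum is dominated convergence, with the mean value theorem bounding the
    difference quotient of the (j-1)-st derivative by the bound on the j-th
    ([sobolev_deriv_scalar]).

    The growth bound ([eigenvalue_growth]) holds with
    kappa = max(0, (beta - n)/2), except that for beta = n it holds with every
    kappa > 0; in that case the strict inequality q < s leaves room for a
    sufficiently small kappa depending on the number of derivatives.  To obtain
    it, put a = (n + 2 - beta)/2, b = (n + 2)/2 and z = |k|^2 delta^2 / 4.  The
    factor (a)_m/(a+1)_m = a/(a+m) in the series shows that each hypergeometric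
    function is an average int_0^1 a t^(a-1) h(t z) dt, where h is built from
    the Bessel function Phi_b(y) = 0F1(;b;-y): h = Phi_b for 1F2,
    h = b (1 - Phi_b)/y for 2F3, and for 3F4 a combination of the latter with
    Phi_(b+1).  An energy inequality gives |Phi_b| <= 1 and
    y Phi_(b+1)^2 <= b^2 for b >= 1/2 ([bessel_energy]), and the three-term
    recurrence turns the first bound into y Phi_(b+2) = O(1).  Since n >= 1
    gives b >= 3/2, h decays like y^(-1/2) for 1F2, which enters squared, and
    like y^(-1) for 2F3 and 3F4.  If h = O(y^(-g)) with g <> a, the average is
    O(z^(-min(a,g))) ([avg_decay]).  The factor |k|^2 of the eigenvalues leaves
    the exponent 1 - min(a,g). *)

(** * Entire power series *)

Lemma ndecr_of_derive (R : realType) (f df : R -> R) (a x y : R) :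
  (forall z, a <= z -> is_derive z 1 f (df z)) ->
  (forall z, a <= z -> 0 <= df z) -> a <= x -> x <= y -> f x <= f y.
Proof.
move=> fdf df0 ax xy.
have fdfx z : z \in `]x, y[ -> is_derive z 1 f (df z).
  by rewrite in_itv/= => /andP[/ltW xz _]; apply: fdf; exact: le_trans xz.
have fc : {within `[x, y], continuous f}.
  apply: derivable_within_continuous => z; rewrite in_itv/= => /andP[xz _].
  by have [] := fdf z (le_trans ax xz).
have [c] := MVT_segment xy fdfx fc.
rewrite in_itv/= => /andP[xc _] fxy; rewrite -subr_ge0 fxy.
by rewrite mulr_ge0 ?subr_ge0// df0// (le_trans ax).
Qed.

Definition psum (R : realType) (c : nat -> R) (y : R) : R := limn (pseries c y).

(** Domination by the exponential series: a class of entire functions that is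
    stable under differentiation, so that no radius of convergence has to be
    tracked. *)
Definition entire_seq (R : realType) (c : nat -> R) : Prop :=
  exists A : R, forall m, `|c m| * m`!%:R <= A.

Lemma cvg_psum (R : realType) (c : nat -> R) (y : R) :
  entire_seq c -> pseries c y @ \oo --> psum c y.
Proof.
move=> [A cA]; apply: (@normed_cvg R R^o).
have A0 : 0 <= A by rewrite (le_trans _ (cA 0%N))// mulr_ge0.
have : cvgn (series (A *: exp_coeff `|y|)).
  exact/is_cvg_seriesZ/is_cvg_series_exp_coeff.
have AE m : (A *: exp_coeff `|y|) m = A / m`!%:R * `|y| ^+ m.
  by rewrite /exp_coeff !fctE/= /GRing.scale/=; ring.
apply: series_le_cvg => m; rewrite ?AE//=; first by rewrite mulr_ge0// divr_ge0.
rewrite normrM normrX.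
by rewrite ler_wpM2r ?exprn_ge0// ler_pdivlMr ?cA// ltr0n fact_gt0.
Qed.

Lemma psum_unique (R : realType) (c : nat -> R) (y l : R) :
  pseries c y @ \oo --> l -> psum c y = l.
Proof. exact: cvg_lim. Qed.

Lemma eq_psum (R : realType) (c d : nat -> R) (y : R) :
  (forall m, c m = d m) -> psum c y = psum d y.
Proof. by move=> cd; congr psum; apply/funext. Qed.

Lemma entire_seq_le (R : realType) (c d : nat -> R) (K : R) :
  entire_seq c -> (forall m, `|d m| <= K * `|c m|) -> entire_seq d.
Proof.
move=> [A cA] dc; exists (`|K| * A) => m.
rewrite (@le_trans _ _ (`|K| * (`|c m| * m`!%:R)))//; last by rewrite ler_wpM2l.
rewrite mulrA ler_wpM2r// (le_trans (dc m))// ler_wpM2r//; exact: ler_norm.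
Qed.

Lemma entire_seq_lin (R : realType) (c d : nat -> R) (a b : R) :
  entire_seq c -> entire_seq d -> entire_seq (fun m => a * c m + b * d m).
Proof.
move=> [A cA] [B dB]; exists (`|a| * A + `|b| * B) => m.
rewrite (@le_trans _ _ ((`|a| * `|c m| + `|b| * `|d m|) * m`!%:R))//.
  by rewrite ler_wpM2r// (le_trans (ler_normD _ _))// !normrM.
by rewrite mulrDl -!mulrA lerD// ler_wpM2l.
Qed.

Lemma psum_lin (R : realType) (c d : nat -> R) (a b y : R) :
  entire_seq c -> entire_seq d ->
  psum (fun m => a * c m + b * d m) y = a * psum c y + b * psum d y.
Proof.
move=> ec ed; apply: psum_unique.
have -> : pseries (fun m => a * c m + b * d m) y =
          (fun N => a * pseries c y N + b * pseries d y N).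
  apply/funext => N; rewrite /pseries /series/= !mulr_sumr -big_split/=.
  by apply: eq_bigr => i _; ring.
by apply: cvgD; (apply: cvgM; [exact: cvg_cst | exact: cvg_psum]).
Qed.

Lemma psum0 (R : realType) (c : nat -> R) : psum c 0 = c 0%N.
Proof.
apply: psum_unique; rewrite -(cvg_shiftn 1)/=.
apply: cvg_near_cst; apply: nearW => m; rewrite /pseries /series/= addn1.
by rewrite big_nat_recl// big1 ?expr0 ?mulr1 ?addr0// => i _; rewrite expr0n mulr0.
Qed.

Lemma psum_shift (R : realType) (c : nat -> R) (y : R) :
  entire_seq c -> entire_seq (fun m => c m.+1) ->
  y * psum (fun m => c m.+1) y = psum c y - c 0%N.
Proof.
move=> ec eSc; apply/eqP; rewrite -subr_eq opprK; apply/eqP/esym.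
apply: psum_unique; rewrite -(cvg_shiftn 1)/=.
have -> : (fun m => pseries c y (m + 1)%N) =
    (fun m => y * pseries (fun m => c m.+1) y m + c 0%N).
  apply/funext => m; rewrite /pseries /series/= addn1.
  rewrite big_nat_recl// expr0 mulr1 addrC; congr +%R.
  by rewrite mulr_sumr; apply: eq_bigr => i _; rewrite exprS; ring.
by apply: cvgD; [apply: cvgM; [exact: cvg_cst | exact: cvg_psum] | exact: cvg_cst].
Qed.

Lemma entire_seq_diffs (R : realType) (c : nat -> R) :
  entire_seq c -> entire_seq (pseries_diffs c).
Proof.
move=> [A cA]; exists A => m; rewrite (le_trans _ (cA m.+1))//.
rewrite /pseries_diffs normrM normr_nat factS natrM.
by rewrite [X in X * _ <= _]mulrC -mulrA.
Qed.

Lemma entire_seqS (R : realType) (c : nat -> R) :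
  entire_seq c -> entire_seq (fun m => c m.+1).
Proof.
move=> /entire_seq_diffs/(@entire_seq_le _ _ _ 1); apply => m.
by rewrite mul1r /pseries_diffs normrM normr_nat ler_peMl// ler1n.
Qed.

Lemma is_derive_psum (R : realType) (c : nat -> R) (y : R) :
  entire_seq c -> is_derive y 1 (psum c) (psum (pseries_diffs c) y).
Proof.
move=> ec; apply: (@pseries_snd_diffs R c (`|y| + 1)).
- by apply/cvg_ex; eexists; exact: cvg_psum.
- by apply/cvg_ex; eexists; exact/cvg_psum/entire_seq_diffs.
- by apply/cvg_ex; eexists; exact/cvg_psum/entire_seq_diffs/entire_seq_diffs.
- by rewrite [ltRHS]ger0_norm ?ltrDl// addr_ge0.
Qed.

(** * The Bessel function 0F1(;b;-y) *)

Lemma pochhammer0 (R : realType) (a : R) : pochhammer a 0 = 1.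
Proof. by rewrite /pochhammer big_ord0. Qed.

Lemma pochhammerSr (R : realType) (a : R) (m : nat) :
  pochhammer a m.+1 = pochhammer a m * (a + m%:R).
Proof. by rewrite /pochhammer big_ord_recr. Qed.

Lemma pochhammerSl (R : realType) (a : R) (m : nat) :
  pochhammer a m.+1 = a * pochhammer (a + 1) m.
Proof.
rewrite /pochhammer big_ord_recl addr0; congr *%R; apply: eq_bigr => i _.
by rewrite -addrA -natr1 [1 + _]addrC.
Qed.

Lemma pochhammer_gt0 (R : realType) (a : R) (m : nat) :
  0 < a -> 0 < pochhammer a m.
Proof. by move=> a0; apply: prodr_gt0 => i _; rewrite ltr_pwDl. Qed.

Lemma pochhammer_neq0 (R : realType) (a : R) (m : nat) :
  0 < a -> pochhammer a m != 0.
Proof. by move=> a0; rewrite gt_eqF ?pochhammer_gt0. Qed.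

Lemma pochhammer_ge1 (R : realType) (a : R) (m : nat) :
  1 <= a -> 1 <= pochhammer a m.
Proof.
move=> a1; rewrite /pochhammer; elim/big_ind: _ => // [x y|i _].
  exact: mulr_ege1.
by apply: (le_trans a1); rewrite lerDl.
Qed.

(** The coefficients of 0F1(;b;-y), which for [b = nu + 1] is
    Gamma (nu + 1) y^(-nu/2) J_nu (2 sqrt y) in terms of Bessel functions. *)
Definition bessel_seq (R : realType) (b : R) (m : nat) : R :=
  (-1) ^+ m / (m`!%:R * pochhammer b m).

Definition bessel (R : realType) (b y : R) : R := psum (bessel_seq b) y.

Lemma entire_bessel_seq (R : realType) (b : R) :
  0 < b -> entire_seq (bessel_seq b).
Proof.
move=> b0; exists (1 + b^-1) => m.
rewrite /bessel_seq normrM normrX normrN1 expr1n mul1r normfV normrM normr_nat.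
rewrite invfM mulrAC mulVf ?mul1r ?pnatr_eq0 -?lt0n ?fact_gt0//.
rewrite (ger0_norm (ltW (pochhammer_gt0 m b0))).
case: m => [|m]; first by rewrite pochhammer0 invr1 lerDl invr_ge0 ltW.
rewrite (@le_trans _ _ b^-1)// ?lerDr// lef_pV2 ?posrE ?pochhammer_gt0//.
by rewrite pochhammerSl ler_peMr ?(ltW b0)// pochhammer_ge1// lerDr ltW.
Qed.

Lemma bessel0 (R : realType) (b : R) : bessel b 0 = 1.
Proof. by rewrite /bessel psum0 /bessel_seq pochhammer0 expr0 mulr1 divr1. Qed.

(** Dividing the m-th coefficient of Phi_b by m lowers m! and shifts the
    Pochhammer symbol, (b)_(m+1) = b (b+1)_m: this is Phi_b' = - Phi_(b+1) / b. *)
Lemma is_derive_bessel (R : realType) (b y : R) :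
  0 < b -> is_derive y 1 (bessel b) (- bessel (b + 1) y / b).
Proof.
move=> b0; apply: is_derive_eq.
  exact/is_derive_psum/entire_bessel_seq.
have b10 : 0 < b + 1 by rewrite addr_gt0.
have e := entire_bessel_seq b10.
rewrite [LHS](_ : _ = psum (fun m => (- b^-1) * bessel_seq (b + 1) m
  + 0 * bessel_seq (b + 1) m) y); first by rewrite psum_lin// mul0r addr0 /bessel; ring.
apply: eq_psum => m.
rewrite /pseries_diffs /bessel_seq pochhammerSl factS natrM exprS.
have mf0 : m`!%:R != 0 :> R by rewrite pnatr_eq0 -lt0n fact_gt0.
have m0 : m.+1%:R != 0 :> R by rewrite pnatr_eq0.
have p0 := pochhammer_neq0 m b10.
field.
by rewrite p0 mf0 gt_eqF//= nat1r m0.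
Qed.

(** Equivalent, by [is_derive_bessel], to Bessel's equation
    y Phi_b'' + b Phi_b' + Phi_b = 0; it needs no second derivative. *)
Lemma bessel_rec (R : realType) (b y : R) : 0 < b ->
  y * bessel (b + 2) y = b * (b + 1) * (bessel (b + 1) y - bessel b y).
Proof.
move=> b0; have b10 : 0 < b + 1 by rewrite addr_gt0.
have b20 : 0 < b + 2 by rewrite addr_gt0.
have e := entire_bessel_seq b0; have e1 := entire_bessel_seq b10.
pose d m := b * (b + 1) * bessel_seq (b + 1) m + (- (b * (b + 1))) * bessel_seq b m.
have ed : entire_seq d by exact: entire_seq_lin.
have -> : bessel (b + 2) y = psum (fun m => d m.+1) y.
  apply: eq_psum => m; rewrite /d /bessel_seq.
  have p2 := pochhammer_neq0 m b20.
  have bm2 : b + 1 + m.+1%:R != 0 by rewrite gt_eqF// ltr_wpDr// ?ler0n.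
  have E : pochhammer (b + 2) m * (b + 1) = pochhammer (b + 1) m * (b + 1 + m%:R).
    rewrite -pochhammerSr pochhammerSl mulrC.
    by have -> : b + 1 + 1 = b + 2 by ring.
  have p1 := pochhammer_neq0 m b10.
  have bm0 : b + 1 + m%:R != 0 by rewrite gt_eqF// ltr_wpDr// ?ler0n.
  rewrite [pochhammer b _]pochhammerSl [pochhammer (b + 1) _]pochhammerSr.
  have -> : pochhammer (b + 2) m = pochhammer (b + 1) m * (b + 1 + m%:R) / (b + 1).
    by rewrite -E mulfK// gt_eqF.
  have mf0 : m`!%:R != 0 :> R by rewrite pnatr_eq0 -lt0n fact_gt0.
  have m0 : m.+1%:R != 0 :> R by rewrite pnatr_eq0.
  rewrite factS natrM exprS; move: m0 bm2; rewrite -natr1 => m0 bm2.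
  by field; rewrite p1 bm0 mf0 m0 !gt_eqF.
rewrite psum_shift//; last exact: entire_seqS.
rewrite /d psum_lin// /bessel_seq !pochhammer0 /bessel /bessel_seq.
by ring.
Qed.

(** The energy method: differentiating along the recurrence, the energy
    Phi_b^2 + y Phi_b'^2 has derivative (1 - 2 b) Phi_b'^2, and it equals 1
    at 0. *)
Lemma bessel_energy (R : realType) (b y : R) : 1 / 2 <= b -> 0 <= y ->
  bessel b y ^+ 2 + y * (bessel (b + 1) y / b) ^+ 2 <= 1.
Proof.
move=> b12 y0; have b0 : 0 < b by rewrite (lt_le_trans _ b12)// divr_gt0.
have b10 : 0 < b + 1 by rewrite addr_gt0.
pose E z := - (bessel b z ^+ 2 + z * (bessel (b + 1) z / b) ^+ 2).
suff : E 0 <= E y by rewrite /E !bessel0 mul0r expr1n addr0 lerN2.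
(* E is minus the energy, which makes it nondecreasing. *)
pose dE z := (2 * b - 1) * (bessel (b + 1) z / b) ^+ 2.
apply: (@ndecr_of_derive _ E dE 0) => // z z0; last first.
  by rewrite mulr_ge0 ?sqr_ge0//; lra.
have db := is_derive_bessel z b0.
have db1 := is_derive_bessel z b10.
apply: is_derive_eq.
rewrite /GRing.scale/= /dE.
have := bessel_rec z b0; have -> : b + 1 + 1 = b + 2 by ring.
set p0 := bessel b z; set p1 := bessel (b + 1) z; set p2 := bessel (b + 2) z.
move=> rec.
have -> : p0 = p1 - z * p2 / (b * (b + 1)).
  by rewrite rec mulrAC mulfV ?mul1r ?mulf_neq0 ?gt_eqF// opprB addrC subrK.
by field; rewrite !gt_eqF.
Qed.

Lemma bessel_le1 (R : realType) (b y : R) :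
  1 / 2 <= b -> 0 <= y -> `|bessel b y| <= 1.
Proof.
move=> b12 y0; rewrite -(@ler_pXn2r _ 2)// ?nnegrE// expr1n -normrX ger0_norm ?sqr_ge0//.
apply: le_trans (bessel_energy b12 y0).
by rewrite lerDl mulr_ge0// sqr_ge0.
Qed.

Lemma bessel_sqr_decay (R : realType) (b y : R) :
  1 / 2 <= b -> 0 <= y -> y * bessel (b + 1) y ^+ 2 <= b ^+ 2.
Proof.
move=> b12 y0; have b0 : 0 < b by rewrite (lt_le_trans _ b12)// divr_gt0.
rewrite -[leRHS]mul1r -ler_pdivrMr ?exprn_gt0// -mulrA -expr_div_n.
apply: le_trans (bessel_energy b12 y0).
by rewrite lerDr sqr_ge0.
Qed.

(** The recurrence expresses y Phi_(b+2) by the bounded functions Phi_b and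
    Phi_(b+1); this gains a full power of y, where the energy alone gains only
    half a power. *)
Lemma bessel_linear_decay (R : realType) (b y : R) :
  1 / 2 <= b -> 0 <= y -> `|y * bessel (b + 2) y| <= 2 * (b * (b + 1)).
Proof.
move=> b12 y0; have b0 : 0 < b by rewrite (lt_le_trans _ b12)// divr_gt0.
rewrite bessel_rec// normrM ger0_norm; last by rewrite mulr_ge0// ?addr_ge0// ltW.
rewrite mulrC ler_wpM2r//; first by rewrite mulr_ge0// ?addr_ge0// ltW.
rewrite (le_trans (ler_normB _ _))// (_ : 2 = 1 + 1 :> R)// lerD// bessel_le1//.
by rewrite ler_wpDr.
Qed.

(** * Decay of averages with a power weight *)

(** The coefficients of z |-> int_0^1 a t^(a-1) (psum c) (t z) dt. *)
Definition avg_seq (R : realType) (a : R) (c : nat -> R) (m : nat) : R :=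
  a / (a + m%:R) * c m.

Lemma entire_avg_seq (R : realType) (a : R) (c : nat -> R) :
  0 < a -> entire_seq c -> entire_seq (avg_seq a c).
Proof.
move=> a0 /(@entire_seq_le _ _ _ 1); apply => m.
rewrite /avg_seq normrM ler_wpM2r// ger0_norm.
  by rewrite ler_pdivrMr ?ltr_pwDl// mul1r lerDl.
by rewrite divr_ge0 ?addr_ge0// ltW.
Qed.

(** Differentiating under the average; in this form the average is studied
    without integrals. *)
Lemma avg_seq_ode (R : realType) (a : R) (c : nat -> R) (y : R) :
  0 < a -> entire_seq c ->
  y * psum (pseries_diffs (avg_seq a c)) y + a * psum (avg_seq a c) y
  = a * psum c y.
Proof.
move=> a0 ec; have ea := entire_avg_seq a0 ec.
pose d m := m%:R * avg_seq a c m.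
have ed : entire_seq d.
  apply: (@entire_seq_le _ c _ a) => // m.
  rewrite /d /avg_seq mulrA normrM ler_wpM2r// ger0_norm.
    by rewrite mulrA ler_pdivrMr ?ltr_pwDl// mulrC ler_wpM2l ?(ltW a0)// lerDr ltW.
  by rewrite mulr_ge0// divr_ge0 ?addr_ge0// ltW.
have := psum_shift y ed (entire_seqS ed).
rewrite [X in _ = _ - X]mul0r subr0 => ->.
rewrite -[psum d y]mul1r -psum_lin//.
transitivity (psum (fun m => a * c m + 0 * c m) y); last first.
  by rewrite psum_lin// mul0r addr0.
apply: eq_psum => m; rewrite /d /avg_seq.
by field; rewrite gt_eqF// ltr_pwDl.
Qed.

Lemma powRN_le (R : realType) (z0 z e m : R) :
  0 < z0 -> z0 <= z -> m <= e -> z `^ (- e) <= z0 `^ (m - e) * z `^ (- m).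
Proof.
move=> z00 z0z me; have zp : 0 < z by exact: lt_le_trans z0z.
rewrite [X in z `^ X](_ : - e = (m - e) + - m); last by ring.
rewrite powRD ?(gt_eqF zp) ?implybT// ler_wpM2r ?powR_ge0//.
have -> : m - e = - (e - m) by ring.
rewrite !powRN lef_pV2 ?posrE ?powR_gt0//.
by rewrite ge0_ler_powR ?subr_ge0// nnegrE ltW.
Qed.

(** By [avg_seq_ode], z^a times the average F has derivative
    a z^(a-1) (psum c z); comparing it with a primitive of z^(a-1-g) bounds
    F by z^(-a) + z^(-g). *)
Lemma avg_decay (R : realType) (a g C z0 : R) (c : nat -> R) :
  0 < a -> 0 < z0 -> g != a -> entire_seq c ->
  (forall z, z0 <= z -> `|psum c z| <= C * z `^ (- g)) ->
  exists K, forall z, z0 <= z ->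
    `|psum (avg_seq a c) z| <= K * z `^ (- Num.min a g).
Proof.
move=> a0 z00 ga ec hc; have ea := entire_avg_seq a0 ec.
pose F := psum (avg_seq a c).
pose D := a * C / (a - g).
have ag0 : a - g != 0 by rewrite subr_eq0 eq_sym.
pose A z := z `^ a * F z.
pose B z := D * z `^ (a - g).
pose dA z := a * z `^ (a - 1) * psum c z.
pose dB z := a * C * z `^ (a - g - 1).
have pos z : z0 <= z -> 0 < z by exact: lt_le_trans.
have isA z : z0 <= z -> is_derive z 1 A (dA z).
  move=> /pos zp; have hp := is_derive1_powR a zp.
  have hF := is_derive_psum z ea.
  apply: is_derive_eq; rewrite /GRing.scale/= /dA.
  transitivity (z `^ (a - 1) * (a * psum c z)); last by ring.
  by rewrite -avg_seq_ode// -(mulr_powRB1 (ltW zp) a0) /F; ring.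
have isB z : z0 <= z -> is_derive z 1 B (dB z).
  move=> /pos zp; have hp := is_derive1_powR (a - g) zp.
  apply: is_derive_eq; rewrite /GRing.scale/= /dB /D.
  by field.
have dAB z : z0 <= z -> `|dA z| <= dB z.
  move=> z0z; have zp := pos _ z0z.
  rewrite /dA /dB normrM ger0_norm; last by rewrite mulr_ge0 ?powR_ge0// ltW.
  have -> : z `^ (a - g - 1) = z `^ (a - 1) * z `^ (- g).
    by rewrite -powRD ?(gt_eqF zp) ?implybT//; congr (_ `^ _); ring.
  rewrite (_ : _ * C * _ = a * z `^ (a - 1) * (C * z `^ (- g))); last by ring.
  by rewrite ler_wpM2l ?hc// mulr_ge0 ?powR_ge0// ltW.
have AB z : z0 <= z -> `|A z - A z0| <= B z - B z0.
  move=> z0z.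
  have h1 := @ndecr_of_derive _ (fun z => B z - A z) (fun z => dB z - dA z) z0 z0 z
    (fun w zw => is_deriveB (isB w zw) (isA w zw)) _ (lexx z0) z0z.
  have h2 := @ndecr_of_derive _ (fun z => B z + A z) (fun z => dB z + dA z) z0 z0 z
    (fun w zw => is_deriveD (isB w zw) (isA w zw)) _ (lexx z0) z0z.
  have {}h1 : B z0 - A z0 <= B z - A z.
    by apply: h1 => w zw; rewrite subr_ge0 (le_trans (ler_norm _))// dAB.
  have {}h2 : B z0 + A z0 <= B z + A z.
    apply: h2 => w zw; rewrite -(opprK (dA w)) subr_ge0.
    by rewrite (le_trans (ler_norm _))// normrN dAB.
  by rewrite ler_norml; apply/andP; split; lra.
pose m := Num.min a g.
have ma : m <= a by rewrite ge_min lexx.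
have mg : m <= g by rewrite ge_min lexx orbT.
pose K1 := `|A z0| + `|B z0|.
exists (K1 * z0 `^ (m - a) + `|D| * z0 `^ (m - g)) => z z0z.
have zp := pos _ z0z.
have -> : psum (avg_seq a c) z = z `^ (- a) * A z.
  by rewrite /A mulrA powRN mulVf ?mul1r// gt_eqF// powR_gt0.
have Az : `|A z| <= K1 + `|D| * z `^ (a - g).
  have := AB z z0z.
  have : B z <= `|D| * z `^ (a - g) by rewrite ler_wpM2r ?powR_ge0// ler_norm.
  have : - B z0 <= `|B z0| by rewrite -normrN ler_norm.
  have : `|A z| <= `|A z - A z0| + `|A z0| by rewrite -{1}(subrK (A z0) (A z)) ler_normD.
  rewrite /K1; lra.
rewrite normrM (ger0_norm (powR_ge0 _ _)) -/m.
apply: (le_trans (ler_wpM2l (powR_ge0 _ _) Az)).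
rewrite mulrDr mulrDl; apply: lerD.
  rewrite mulrC -mulrA ler_wpM2l ?powRN_le//.
  by rewrite /K1 addr_ge0.
rewrite mulrCA -powRD ?(gt_eqF zp) ?implybT//.
have -> : - a + (a - g) = - g by ring.
by rewrite -mulrA ler_wpM2l ?powRN_le.
Qed.

(** * The hypergeometric functions as averages of Bessel functions *)

Lemma pochhammer_shift (R : realType) (a : R) (m : nat) :
  0 < a -> pochhammer a m / pochhammer (a + 1) m = a / (a + m%:R).
Proof.
move=> a0; have am0 : 0 < a + m%:R by rewrite ltr_pwDl.
have p0 := @pochhammer_neq0 _ (a + 1) m (addr_gt0 a0 ltr01).
apply/eqP; rewrite (eqr_div _ _ p0) ?lt0r_neq0//.
by rewrite -pochhammerSr pochhammerSl mulrC.
Qed.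

(** [mean_bessel_seq b] has the sum b (1 - 0F1(;b;-y)) / y, the average of
    0F1(;b + 1;-t) over t in [0, y]. *)
Definition mean_bessel_seq (R : realType) (b : R) (m : nat) : R :=
  bessel_seq (b + 1) m / m.+1%:R.

Lemma entire_mean_bessel_seq (R : realType) (b : R) :
  0 < b -> entire_seq (mean_bessel_seq b).
Proof.
move=> b0; apply: (@entire_seq_le _ (bessel_seq (b + 1)) _ 1).
  by apply: entire_bessel_seq; rewrite addr_gt0.
move=> m; rewrite mul1r /mean_bessel_seq normrM ler_piMr// normfV normr_nat.
by rewrite invf_le1// ler1n.
Qed.

Lemma psum_mean_bessel (R : realType) (b y : R) : 0 < b ->
  y * psum (mean_bessel_seq b) y = b * (1 - bessel b y).
Proof.
move=> b0; have e := entire_bessel_seq b0.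
pose c m := (- b) * bessel_seq b m + 0 * bessel_seq b m.
have ec : entire_seq c by exact: entire_seq_lin.
transitivity (y * psum (fun m => c m.+1) y).
  congr *%R; apply: eq_psum => m; rewrite /c /mean_bessel_seq /bessel_seq.
  rewrite pochhammerSl factS natrM exprS.
  have mf0 : m`!%:R != 0 :> R by rewrite pnatr_eq0 -lt0n fact_gt0.
  have m0 : m.+1%:R != 0 :> R by rewrite pnatr_eq0.
  have p0 := @pochhammer_neq0 _ (b + 1) m (addr_gt0 b0 ltr01).
  by field; rewrite nat1r p0 mf0 m0 gt_eqF.
rewrite psum_shift//; last exact: entire_seqS.
have -> : c 0%N = - b by rewrite /c /bessel_seq pochhammer0 fact0 expr0 mul0r; field.
by rewrite /c psum_lin// /bessel; ring.
Qed.

(** In 3F4 the quotient (5/2)_m / (3/2)_m = 1 + 2 m / 3 is an affine function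
    of m, namely (2 (m + 1) + 1) / 3; divided by (2)_m / (1)_m = m + 1 it gives
    these two terms. *)
Definition mix_bessel_seq (R : realType) (b : R) (m : nat) : R :=
  2 / 3 * bessel_seq (b + 1) m + 1 / 3 * mean_bessel_seq b m.

Lemma entire_mix_bessel_seq (R : realType) (b : R) :
  0 < b -> entire_seq (mix_bessel_seq b).
Proof.
move=> b0; apply: entire_seq_lin; last exact: entire_mean_bessel_seq.
by apply: entire_bessel_seq; rewrite addr_gt0.
Qed.

Lemma hypergeomN (R : realType) (l1 l2 : seq R) (c : nat -> R) (y : R) :
  (forall m, (\prod_(x <- l1) pochhammer x m) / (\prod_(x <- l2) pochhammer x m)
     * ((-1) ^+ m / m`!%:R) = c m) ->
  hypergeom l1 l2 (- y) = psum c y.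
Proof.
move=> lc; rewrite /hypergeom /psum /pseries; congr (limn (series _)).
by apply/funext => m /=; rewrite -lc (exprNn y) -!mulrA [_ / m`!%:R]mulrC.
Qed.

Lemma pochhammer1 (R : realType) (m : nat) : pochhammer (1 : R) m = m`!%:R.
Proof.
elim: m => [|m IH]; first by rewrite pochhammer0.
by rewrite pochhammerSr IH factS natrM mulrC nat1r.
Qed.

Lemma pochhammer2 (R : realType) (m : nat) : pochhammer (2 : R) m = m.+1`!%:R.
Proof. by rewrite -pochhammer1 pochhammerSl mul1r. Qed.

Lemma hypergeom12E (R : realType) (a b y : R) : 0 < a -> 0 < b ->
  hypergeom [:: a] [:: b; a + 1] (- y) = psum (avg_seq a (bessel_seq b)) y.
Proof.
move=> a0 b0; apply: hypergeomN => m; rewrite !big_cons !big_nil.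
rewrite /avg_seq -pochhammer_shift// /bessel_seq.
have mf0 : m`!%:R != 0 :> R by rewrite pnatr_eq0 -lt0n fact_gt0.
have pb := pochhammer_neq0 m b0.
have pa := @pochhammer_neq0 _ (a + 1) m (addr_gt0 a0 ltr01).
by field; rewrite pa pb mf0.
Qed.

Lemma hypergeom23E (R : realType) (a b y : R) : 0 < a -> 0 < b ->
  hypergeom [:: 1; a] [:: 2; b + 1; a + 1] (- y)
  = psum (avg_seq a (mean_bessel_seq b)) y.
Proof.
move=> a0 b0; apply: hypergeomN => m; rewrite !big_cons !big_nil.
rewrite /avg_seq -pochhammer_shift// /mean_bessel_seq /bessel_seq.
rewrite pochhammer1 pochhammer2 factS natrM.
have mf0 : m`!%:R != 0 :> R by rewrite pnatr_eq0 -lt0n fact_gt0.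
have m0 : m.+1%:R != 0 :> R by rewrite pnatr_eq0.
have pb := @pochhammer_neq0 _ (b + 1) m (addr_gt0 b0 ltr01).
have pa := @pochhammer_neq0 _ (a + 1) m (addr_gt0 a0 ltr01).
by field; rewrite nat1r pa pb mf0 m0.
Qed.

Lemma hypergeom34E (R : realType) (a b y : R) : 0 < a -> 0 < b ->
  hypergeom [:: 1; 5 / 2; a] [:: 2; 3 / 2; b + 1; a + 1] (- y)
  = psum (avg_seq a (mix_bessel_seq b)) y.
Proof.
move=> a0 b0; apply: hypergeomN => m; rewrite !big_cons !big_nil.
rewrite /avg_seq -pochhammer_shift// /mix_bessel_seq /mean_bessel_seq /bessel_seq.
have p52 : pochhammer (5 / 2) m = (1 + 2 / 3 * m%:R) * pochhammer (3 / 2) m :> R.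
  have -> : 5 / 2 = 3 / 2 + 1 :> R by field.
  apply: (@mulfI _ (3 / 2)); first by rewrite gt_eqF// divr_gt0.
  by rewrite -pochhammerSl pochhammerSr; field.
have p32 : pochhammer (3 / 2) m != 0 :> R by rewrite pochhammer_neq0// divr_gt0.
rewrite p52 pochhammer1 pochhammer2 factS natrM.
have mf0 : m`!%:R != 0 :> R by rewrite pnatr_eq0 -lt0n fact_gt0.
have m0 : m.+1%:R != 0 :> R by rewrite pnatr_eq0.
have pb := @pochhammer_neq0 _ (b + 1) m (addr_gt0 b0 ltr01).
have pa := @pochhammer_neq0 _ (a + 1) m (addr_gt0 a0 ltr01).
move: p32; set p := pochhammer (3 / 2) m => p32; clear p52.
by field; rewrite nat1r pa pb mf0 m0 p32.
Qed.

(** Decay exponents may be lowered on a half-line away from 0: [avg_decay]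
    requires g <> a, so g = 1 is not always admissible. *)
Lemma inv_decay (R : realType) (z0 z g C x : R) :
  0 < z0 -> z0 <= z -> g <= 1 -> `|z * x| <= C ->
  `|x| <= C * z0 `^ (g - 1) * z `^ (- g).
Proof.
move=> z00 z0z g1 zx; have zp : 0 < z by exact: lt_le_trans z0z.
have C0 : 0 <= C by rewrite (le_trans _ zx).
rewrite -mulrA; apply: le_trans (ler_wpM2l C0 (powRN_le z00 z0z g1)).
rewrite (powR_inv1 (ltW zp)) ler_pdivlMr//.
by rewrite normrM gtr0_norm// mulrC in zx.
Qed.

Lemma bessel_half_decay (R : realType) (b g z0 z : R) :
  3 / 2 <= b -> 0 < z0 -> z0 <= z -> g <= 1 / 2 ->
  `|bessel b z| <= (b - 1) * z0 `^ (g - 1 / 2) * z `^ (- g).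
Proof.
move=> b32 z00 z0z g12; have zp : 0 < z by exact: lt_le_trans z0z.
have b1 : 0 <= b - 1 by lra.
rewrite -mulrA; apply: le_trans (ler_wpM2l b1 (powRN_le z00 z0z g12)).
have := @bessel_sqr_decay _ (b - 1) z _ (ltW zp); rewrite subrK => h.
rewrite powRN mul1r (powR12_sqrt (ltW zp)) ler_pdivlMr ?sqrtr_gt0//.
rewrite -(@ler_pXn2r _ 2)// ?nnegrE ?mulr_ge0// ?sqrtr_ge0//.
rewrite exprMn (sqr_sqrtr (ltW zp)) real_normK ?num_real// mulrC; apply: h; lra.
Qed.

Lemma mean_bessel_le (R : realType) (b z : R) : 1 / 2 <= b -> 0 <= z ->
  `|z * psum (mean_bessel_seq b) z| <= 2 * b.
Proof.
move=> b12 z0; have b0 : 0 < b by rewrite (lt_le_trans _ b12)// divr_gt0.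
rewrite psum_mean_bessel// normrM gtr0_norm// mulrC ler_wpM2r ?(ltW b0)//.
rewrite (le_trans (ler_normB _ _))// normr1 (_ : 2 = 1 + 1 :> R)// lerD2l.
exact: bessel_le1.
Qed.

Lemma mix_bessel_le (R : realType) (b z : R) : 3 / 2 <= b -> 0 <= z ->
  `|z * psum (mix_bessel_seq b) z| <= 2 * ((b - 1) * b) + 2 * b.
Proof.
move=> b32 z0; have b0 : 0 < b by lra.
have b12 : 1 / 2 <= b by lra.
rewrite /mix_bessel_seq psum_lin; last 2 first.
  by apply: entire_bessel_seq; rewrite addr_gt0.
  exact: entire_mean_bessel_seq.
have := mean_bessel_le b12 z0.
have := @bessel_linear_decay _ (b - 1) z _ z0.
have -> : b - 1 + 2 = b + 1 by ring.
rewrite subrK -/(bessel (b + 1) z) => /(_ ltac:(lra)).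
set B := bessel _ _; set M := psum _ _ => hB hM.
have -> : z * (2 / 3 * B + 1 / 3 * M) = 2 / 3 * (z * B) + 1 / 3 * (z * M) by ring.
rewrite (le_trans (ler_normD _ _))// !(normrM (_ / _)).
rewrite !(ger0_norm (divr_ge0 _ _))//.
rewrite lerD//.
  rewrite (le_trans _ hB)// ler_piMl//; lra.
rewrite (le_trans _ hM)// ler_piMl//; lra.
Qed.

(** * Growth of the eigenvalues *)

Lemma sqnorm_ge0 (R : realType) (n : nat) (v : 'cV[R]_n) : 0 <= sqnorm v.
Proof. by apply: sumr_ge0 => i _; exact: sqr_ge0. Qed.

Lemma sqnorm_int_vec_ge1 (R : realType) (n : nat) (k : 'cV[int]_n) :
  k != 0 -> 1 <= sqnorm (int_vec R k).
Proof.
move=> k0; have [i ki] : exists i, k i 0 != 0.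
  apply/existsP; apply: contraNT k0; rewrite negb_exists => /forallP h.
  by apply/eqP/matrixP => i j; rewrite ord1 mxE; apply/eqP; have := h i; rewrite negbK.
rewrite /sqnorm (bigD1 i)//= ler_wpDr//; first by apply: sumr_ge0 => j _; exact: sqr_ge0.
rewrite mxE -real_normK ?num_real// -intr_norm exprn_ege1//.
by rewrite -[1]/(1%:~R) ler_int -gtz0_ge1 normr_gt0.
Qed.

(** [1 - Num.min a g] with [g = 1] is max(0, (beta - n) / 2); the freedom in
    [g] replaces the logarithm that appears for [a = 1]. *)
Lemma eigenvalue_growth (R : realType) (n : nat) (delta beta mu lam g : R) :
  let a := (n%:R + 2 - beta) / 2 in
  (1 <= n)%N -> 0 < delta -> 0 < a -> 0 < g -> g <= 1 -> g != a ->
  exists2 C : R, 0 <= C & forall k : 'cV[int]_n, k != 0 ->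
    `|lambda1 delta beta mu lam (int_vec R k)|
       <= C * (1 + sqnorm (int_vec R k)) `^ (1 - Num.min a g) /\
    `|lambda2 delta beta mu (int_vec R k)|
       <= C * (1 + sqnorm (int_vec R k)) `^ (1 - Num.min a g).
Proof.
move=> a n1 d0 a0 g0 g1 ga.
pose b : R := (n%:R + 2) / 2.
pose m := Num.min a g.
have b32 : 3 / 2 <= b.
  rewrite /b ler_pM2r ?invr_gt0// -lerBlDr (_ : 3 - 2 = 1%:R); last by ring.
  by rewrite ler_nat.
have b12 : 1 / 2 <= b by lra.
have b0 : 0 < b by lra.
have m0 : 0 < m by rewrite lt_min a0.
have m1 : m <= 1 by rewrite ge_min g1 orbT.
have ma : m <= a by rewrite ge_min lexx.
pose z0 := 1 / 4 * delta ^+ 2.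
have z00 : 0 < z0 by rewrite mulr_gt0// exprn_gt0.
pose F12 z := psum (avg_seq a (bessel_seq b)) z.
pose F23 z := psum (avg_seq a (mean_bessel_seq b)) z.
pose F34 z := psum (avg_seq a (mix_bessel_seq b)) z.
(* 1F2 enters squared in lambda1, so half the exponent suffices; it is smaller
   than a, and Phi_b decays only like z^(-1/2). *)
have [K1 F12le] : exists K, forall z, z0 <= z -> `|F12 z| <= K * z `^ (- (m / 2)).
  have m2a : m / 2 < a by lra.
  have [||z z0z|K hK] := @avg_decay _ a (m / 2) ((b - 1) * z0 `^ (m / 2 - 1 / 2)) z0
    (bessel_seq b) a0 z00.
  - by rewrite lt_eqF.
  - exact: entire_bessel_seq.
  - apply: bessel_half_decay => //; lra.
  - by exists K => z /hK; rewrite min_r// ltW.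
have [K2 F23le] : exists K, forall z, z0 <= z -> `|F23 z| <= K * z `^ (- m).
  apply: (@avg_decay _ a g (2 * b * z0 `^ (g - 1))) => //.
    exact: entire_mean_bessel_seq.
  move=> z z0z; apply: inv_decay => //; apply: mean_bessel_le => //.
  by rewrite ltW// (lt_le_trans z00).
have [K3 F34le] : exists K, forall z, z0 <= z -> `|F34 z| <= K * z `^ (- m).
  apply: (@avg_decay _ a g ((2 * ((b - 1) * b) + 2 * b) * z0 `^ (g - 1))) => //.
    exact: entire_mix_bessel_seq.
  move=> z z0z; apply: inv_decay => //; apply: mix_bessel_le => //.
  by rewrite ltW// (lt_le_trans z00).
pose L1 := `|3 * mu| * `|K3| + `|lam - mu| * K1 ^+ 2.
pose L2 := `|mu| * `|K2|.
have L10 : 0 <= L1 by rewrite addr_ge0// mulr_ge0// sqr_ge0.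
have L20 : 0 <= L2 by rewrite mulr_ge0.
exists (z0 `^ (- m) * (L1 + L2)); first by rewrite mulr_ge0 ?powR_ge0// addr_ge0.
move=> k k0; set s := sqnorm (int_vec R k).
have s1 : 1 <= s by exact: sqnorm_int_vec_ge1.
have sp : 0 < s by rewrite (lt_le_trans ltr01).
pose z := z0 * s.
have z0z : z0 <= z by rewrite ler_peMr// ltW.
have zp : 0 < z by exact: lt_le_trans z0z.
have szm : s * z `^ (- m) <= z0 `^ (- m) * (1 + s) `^ (1 - m).
  rewrite /z (powRM _ (ltW z00) (ltW sp)) mulrCA ler_wpM2l ?powR_ge0//.
  rewrite -{1}(powRr1 (ltW sp)) -powRD ?(gt_eqF sp) ?implybT//.
  have s0 := ltW sp.
  by apply: ge0_ler_powR; rewrite ?nnegrE ?subr_ge0 ?lerDr ?addr_ge0.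
have E1 : lambda1 delta beta mu lam (int_vec R k) =
    - s * (3 * mu * F34 z + (lam - mu) * F12 z ^+ 2).
  rewrite /lambda1 -/s /F34 /F12 -hypergeom34E// -hypergeom12E//.
  have -> : - (1 / 4) * s * delta ^+ 2 = - z by rewrite /z /z0; ring.
  have -> : (n%:R + 4) / 2 = b + 1 by rewrite /b; field.
  by have -> : (n%:R + 4 - beta) / 2 = a + 1 by rewrite /a; field.
have E2 : lambda2 delta beta mu (int_vec R k) = - s * (mu * F23 z).
  rewrite /lambda2 -/s /F23 -hypergeom23E//.
  have -> : - (1 / 4) * s * delta ^+ 2 = - z by rewrite /z /z0; ring.
  have -> : (n%:R + 4) / 2 = b + 1 by rewrite /b; field.
  have -> : (n%:R + 4 - beta) / 2 = a + 1 by rewrite /a; field.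
  by ring.
have fin (x L : R) : `|x| <= L * z `^ (- m) -> 0 <= L -> L <= L1 + L2 ->
    `|- s * x| <= z0 `^ (- m) * (L1 + L2) * (1 + s) `^ (1 - m).
  move=> xL L0 LL; rewrite normrM normrN (gtr0_norm sp).
  apply: (le_trans (ler_wpM2l (ltW sp) xL)).
  rewrite mulrCA mulrAC [leRHS]mulrC; apply: ler_pM => //.
  by rewrite mulr_ge0 ?powR_ge0// ltW.
have nK (K x : R) : `|x| <= K * z `^ (- m) -> `|x| <= `|K| * z `^ (- m).
  by move=> /le_trans; apply; rewrite ler_wpM2r ?powR_ge0// ler_norm.
split; [rewrite E1|rewrite E2].
- apply: (fin _ L1) => //; last by rewrite lerDl.
  rewrite (le_trans (ler_normD _ _))// [leRHS]mulrDl lerD// normrM -mulrA ler_wpM2l//.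
    by rewrite nK// F34le.
  rewrite normrX -(normr_id (F12 z))
    (_ : z `^ (- m) = (z `^ (- (m / 2))) ^+ 2); last first.
    by rewrite -powR_mulrn ?powR_ge0// -powRrM; congr (_ `^ _); field.
  by rewrite normr_id -exprMn lerXn2r// ?nnegrE// ?F12le// (le_trans _ (F12le _ z0z)).
- apply: (fin _ L2) => //; last by rewrite lerDr.
  by rewrite normrM -mulrA ler_wpM2l// nK// F23le.
Qed.

(** * Sobolev norms through finite partial sums *)

(** Bounding all finite partial sums by one real number replaces extended-real
    arithmetic by real inequalities between finite sums. *)
Lemma esum_le_fsetP (R : realType) (T : choiceType) (a : T -> R) (B : R) :
  (forall k, 0 <= a k) ->
  (\esum_(k in [set: T]) (a k)%:E <= B%:E)%E <->
  forall A : {fset T}, \sum_(k <- A) a k <= B.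
Proof.
move=> a0; split=> [aB A|aB].
  rewrite -lee_fin (le_trans _ aB)// -sumEFin; apply: esum_ge.
  exists [set` A]; first by split.
  by rewrite fsbig_finite//= set_fsetK.
apply: ge_ereal_sup => _ [F [Ffin _] <-].
by rewrite fsbig_finite//= sumEFin lee_fin.
Qed.

Definition sobolev_term (R : realType) (n : nat) (q : R) (g : fourier_coefs R n)
    (k : 'cV[int]_n) : R :=
  (1 + sqnorm (int_vec R k)) `^ q * sqnormC (g k).

Lemma sqnormC_ge0 (R : realType) (n : nat) (v : 'cV[R[i]]_n) : 0 <= sqnormC v.
Proof. by apply: sumr_ge0 => i _; rewrite addr_ge0 ?sqr_ge0. Qed.

Lemma sobolev_term_ge0 (R : realType) (n : nat) (q : R) (g : fourier_coefs R n)
    (k : 'cV[int]_n) : 0 <= sobolev_term q g k.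
Proof. by rewrite mulr_ge0 ?powR_ge0 ?sqnormC_ge0. Qed.

Lemma in_sobolevP (R : realType) (n : nat) (q : R) (g : fourier_coefs R n) :
  in_sobolev q g <->
  exists B : R, forall A : {fset 'cV[int]_n}, \sum_(k <- A) sobolev_term q g k <= B.
Proof.
have t0 := @sobolev_term_ge0 R n q g.
rewrite /in_sobolev /sobolev_norm; set S := (\esum_(k in _) _)%E.
have S0 : (0 <= S)%E by apply: esum_ge0 => k _; rewrite lee_fin t0.
have -> : (sqrte S < +oo)%E = (S < +oo)%E by case: S S0 => //= r _; rewrite !ltry.
split=> [Sfin|[B /(esum_le_fsetP _ t0) SB]]; last exact: le_lt_trans SB (ltry _).
exists (fine S); apply/(esum_le_fsetP _ t0).
by rewrite -/S fineK// ge0_fin_numE.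
Qed.

Lemma sobolev_cvg0P (R : realType) (n : nat) (q : R) (F : set_system R)
    (FF : Filter F) (G : R -> fourier_coefs R n) :
  sobolev_norm q (G h) @[h --> F] --> 0%E <->
  forall e, 0 < e -> \forall h \near F,
    forall A : {fset 'cV[int]_n}, \sum_(k <- A) sobolev_term q (G h) k <= e.
Proof.
have t0 h := @sobolev_term_ge0 R n q (G h).
split=> [GF e e0|GF].
  have se : (0 < (Num.sqrt e)%:E)%E by rewrite lte_fin sqrtr_gt0.
  have /GF := open_ereal_lt' se.
  apply: (@filterS _ F) => h /= hlt; apply/(esum_le_fsetP _ (t0 h)).
  by rewrite -lee_sqrt ?lee_fin ?(ltW e0)//; exact: ltW.
move=> P P0.
have /nbhs_ballP[e /= e0 eP] : nbhs (0 : R) (fun r => P r%:E) := P0.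
have e20 : 0 < e / 2 by rewrite divr_gt0.
apply: filterS (GF _ (exprn_gt0 2 e20)) => h /(esum_le_fsetP _ (t0 h)) hle /=.
have : (sobolev_norm q (G h) <= (e / 2)%:E)%E.
  have -> : (e / 2)%:E = sqrte (((e / 2) ^+ 2)%:E).
    by rewrite /= sqrtr_sqr ger0_norm// ltW.
  by rewrite lee_sqrt// lee_fin sqr_ge0.
have : (0 <= sobolev_norm q (G h))%E by exact: sqrte_ge0.
case: (sobolev_norm q (G h)) => // r; rewrite !lee_fin => r0 re; apply: eP.
rewrite -ball_normE /= sub0r normrN ger0_norm// (le_lt_trans re)//.
by rewrite ltr_pdivrMr// ltr_pMr// ltr1n.
Qed.

Lemma sqnormCZ (R : realType) (n : nat) (c : R) (v : 'cV[R[i]]_n) :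
  sqnormC (c%:C *: v) = c ^+ 2 * sqnormC v.
Proof.
rewrite /sqnormC mulr_sumr; apply: eq_bigr => i _; rewrite !mxE.
by case: (v i 0) => x y /=; ring.
Qed.

Lemma sqnormCD (R : realType) (n : nat) (u v : 'cV[R[i]]_n) :
  sqnormC (u + v) <= 2 * (sqnormC u + sqnormC v).
Proof.
rewrite /sqnormC -big_split/= mulr_sumr; apply: ler_sum => i _; rewrite !mxE.
case: (u i 0) (v i 0) => [x y] [x' y'] /=.
have := sqr_ge0 (x - x'); have := sqr_ge0 (y - y'); nra.
Qed.

Lemma in_sobolev_dom (R : realType) (n : nat) (q s K : R)
    (g f : fourier_coefs R n) : 0 <= K ->
  (forall k, sobolev_term q g k <= K * sobolev_term s f k) ->
  in_sobolev s f -> in_sobolev q g.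
Proof.
move=> K0 gf /in_sobolevP[B fB]; apply/in_sobolevP; exists (K * B) => A.
apply: le_trans (ler_wpM2l K0 (fB A)).
by rewrite mulr_sumr; exact: ler_sum.
Qed.

Lemma sobolev_termD (R : realType) (n : nat) (q : R) (f g : fourier_coefs R n) k :
  sobolev_term q (fun k => f k + g k) k
    <= 2 * sobolev_term q f k + 2 * sobolev_term q g k.
Proof.
by rewrite -mulrDr -[X in 2 * X]mulrDr mulrCA ler_wpM2l ?powR_ge0 ?sqnormCD.
Qed.

Lemma in_sobolevD (R : realType) (n : nat) (q : R) (f g : fourier_coefs R n) :
  in_sobolev q f -> in_sobolev q g -> in_sobolev q (fun k => f k + g k).
Proof.
move=> /in_sobolevP[B fB] /in_sobolevP[C gC]; apply/in_sobolevP.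
exists (2 * B + 2 * C) => A.
apply: (@le_trans _ _ (2 * (\sum_(k <- A) sobolev_term q f k)
                       + 2 * (\sum_(k <- A) sobolev_term q g k))).
  by rewrite !mulr_sumr -big_split/=; apply: ler_sum => k _; exact: sobolev_termD.
by rewrite lerD// ler_wpM2l.
Qed.

Lemma sobolev_derivD (R : realType) (n : nat) (q t : R)
    (U V : R -> fourier_coefs R n) (dU dV : fourier_coefs R n) :
  sobolev_deriv q U t dU -> sobolev_deriv q V t dV ->
  sobolev_deriv q (fun t k => U t k + V t k) t (fun k => dU k + dV k).
Proof.
rewrite /sobolev_deriv => /sobolev_cvg0P hU /sobolev_cvg0P hV.
apply/sobolev_cvg0P => e e0; have e40 : 0 < e / 4 by rewrite divr_gt0.
apply: filterS2 (hU _ e40) (hV _ e40) => h hUe hVe A.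
apply: (@le_trans _ _
    (2 * (\sum_(k <- A) sobolev_term q (fun k => diff_quot U t h k - dU k) k)
     + 2 * (\sum_(k <- A) sobolev_term q (fun k => diff_quot V t h k - dV k) k))).
  rewrite !mulr_sumr -big_split/=; apply: ler_sum => k _.
  rewrite (le_trans _ (sobolev_termD _ _ _ _))//.
  rewrite (_ : sobolev_term _ _ _ = sobolev_term q
    (fun k => (diff_quot U t h k - dU k) + (diff_quot V t h k - dV k)) k)//.
  rewrite /sobolev_term /diff_quot; congr (_ * sqnormC _).
  by rewrite [RHS]addrACA -scalerDr -opprD; congr (_ *: _ - _); rewrite opprD addrACA.
have := hUe A; have := hVe A; lra.
Qed.

Lemma sobolev_CpD (R : realType) (n p : nat) (q : R) (U V : R -> fourier_coefs R n) :
  sobolev_Cp p q U -> sobolev_Cp p q V ->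
  sobolev_Cp p q (fun t k => U t k + V t k).
Proof.
elim: p U V => [|p IH] U V [Uq dU] [Vq dV]; split.
- by move=> t t0; apply: in_sobolevD; [exact: Uq | exact: Vq].
- by [].
- by move=> t t0; apply: in_sobolevD; [exact: Uq | exact: Vq].
case: dU dV => U' [dU CU] [V' [dV CV]].
exists (fun t k => U' t k + V' t k); split; last exact: IH.
by move=> t t0; apply: sobolev_derivD; [exact: dU | exact: dV].
Qed.

(** * Differentiation under the sum *)

(** Dominated convergence for series: a finite set A0 carries the dominating
    sum up to e/2, the tail is small uniformly in h, and the finitely many
    remaining terms tend to 0. *)
Lemma dominated_fset_sums (R : realType) (T : choiceType) (F : set_system R)
    (FF : Filter F) (u : R -> T -> R) (a : T -> R) (B : R) :
  (forall h k, 0 <= u h k) -> (forall k, 0 <= a k) ->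
  (\forall h \near F, forall k, u h k <= a k) ->
  (forall k, u h k @[h --> F] --> (0 : R)) ->
  (forall A : {fset T}, \sum_(k <- A) a k <= B) ->
  forall e, 0 < e -> \forall h \near F,
    forall A : {fset T}, \sum_(k <- A) u h k <= e.
Proof.
move=> u0 a0 ua ucvg aB e e0.
pose E := [set x | exists A : {fset T}, \sum_(k <- A) a k = x].
have supE : has_sup E.
  split; first by exists (\sum_(k <- (fset0 : {fset T})) a k), fset0.
  by exists B => _ [A <-].
have e20 : 0 < e / 2 by rewrite divr_gt0.
have [_ [A0 <-] A0sup] := sup_adherent e20 supE.
have : \sum_(k <- A0) u h k @[h --> F] --> \sum_(k <- A0) (0 : R).
  by apply: (@cvg_big _ _ +%R 0 xpredT) => //; exact: add_continuous.
rewrite big1// => /cvgrPdist_lt/(_ _ e20) A0u.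
apply: filterS2 ua A0u => h uah A0h A.
pose U := (A0 `|` A)%fset.
have restr (D : {fset T}) f : (D `<=` U)%fset ->
    \sum_(k <- D) f k = \sum_(k <- U | k \in D) f k :> R.
  move=> DU; transitivity (\sum_(k <- D) (if k \in D then f k else 0)).
    by apply: eq_big_seq => k ->.
  rewrite [RHS]big_mkcond/=; apply: big_fset_incl => // k _ /negbTE -> //.
have splitU f : \sum_(k <- U) f k =
    \sum_(k <- A0) f k + \sum_(k <- U | k \notin A0) f k :> R.
  by rewrite (restr A0) ?fsubsetUl// [LHS](bigID [in A0]).
have AU : \sum_(k <- A) u h k <= \sum_(k <- U) u h k.
  rewrite (restr A) ?fsubsetUr// big_mkcond/=; apply: ler_sum => k _.
  by case: ifP.
have tail : \sum_(k <- U | k \notin A0) u h k <= \sum_(k <- U | k \notin A0) a k.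
  by apply: ler_sum => k _; exact: uah.
have Usup : \sum_(k <- U) a k <= sup E by apply: (sup_upper_bound supE); exists U.
move: AU Usup A0h A0sup tail; rewrite !splitU sub0r normrN.
rewrite ger0_norm ?sumr_ge0//; lra.
Qed.

Lemma lipschitz_of_derive (R : realType) (f df : R -> R) (M x y : R) :
  (forall z : R, is_derive z 1 f (df z)) -> (forall z, `|df z| <= M) ->
  `|f y - f x| <= M * `|y - x|.
Proof.
move=> fdf dfM.
have fc z z' : {within `[z, z'], continuous f}.
  by apply: derivable_within_continuous => w _; have [] := fdf w.
have fd (z z' w : R) : w \in `]z, z'[ -> is_derive w 1 f (df w) by [].
have [xy|/ltW yx] := leP x y.
  have [c _ ->] := MVT_segment xy (fd _ _) (fc _ _).
  by rewrite normrM ler_wpM2r.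
have [c _ fE] := MVT_segment yx (fd _ _) (fc _ _).
by rewrite distrC fE normrM distrC ler_wpM2r.
Qed.

Definition scalar_family (R : realType) (n : nat) (phi : 'cV[int]_n -> R -> R)
    (w : fourier_coefs R n) (t : R) : fourier_coefs R n :=
  fun k => (phi k t)%:C *: w k.


(** Dominated convergence: each coefficient of the difference quotient tends
    to its limit, and the mean value theorem dominates it by [M k]. *)
Lemma sobolev_deriv_scalar (R : realType) (n : nat) (q t : R)
    (phi psi : 'cV[int]_n -> R -> R) (M : 'cV[int]_n -> R)
    (w : fourier_coefs R n) :
  (forall k (x : R), is_derive x 1 (phi k) (psi k x)) ->
  (forall k x, `|psi k x| <= M k) ->
  in_sobolev q (fun k => (M k)%:C *: w k) ->
  sobolev_deriv q (scalar_family phi w) t (scalar_family psi w t).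
Proof.
move=> dphi psiM /in_sobolevP[B wB].
pose D h k := h^-1 * (phi k (t + h) - phi k t) - psi k t.
have DE h k : diff_quot (scalar_family phi w) t h k - scalar_family psi w t k
    = (D h k)%:C *: w k.
  rewrite /diff_quot /scalar_family -scalerBl scalerA -scalerBl.
  by rewrite -!rmorphB/= -rmorphM/= -rmorphB.
have termE (c : 'cV[int]_n -> R) k : sobolev_term q (fun k => (c k)%:C *: w k) k =
    sobolev_term q w k * c k ^+ 2 by rewrite /sobolev_term sqnormCZ; ring.
rewrite /sobolev_deriv.
rewrite [X in X @ _](_ : _ = (fun h => sobolev_norm q (fun k => (D h k)%:C *: w k))).
  apply: cvg_within_filter; apply/(sobolev_cvg0P q _ (fun h k => (D h k)%:C *: w k)).
  apply: (@dominated_fset_sums _ _ _ _ _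
    (fun k => 4 * sobolev_term q (fun k => (M k)%:C *: w k) k) (4 * B)).
  - by move=> h k; exact: sobolev_term_ge0.
  - by move=> k; rewrite mulr_ge0// sobolev_term_ge0.
  - near=> h => k; have h0 : h != 0 by near: h; exact: nbhs_dnbhs_neq.
    rewrite !termE [leRHS]mulrCA ler_wpM2l ?sobolev_term_ge0//.
    have -> : 4 * M k ^+ 2 = (2 * M k) ^+ 2 by ring.
    have M0 : 0 <= M k by rewrite (le_trans _ (psiM k 0)).
    rewrite -real_normK ?num_real// lerXn2r// ?nnegrE ?mulr_ge0//.
    rewrite (le_trans (ler_normB _ _))// (_ : 2 * M k = M k + M k); last by ring.
    rewrite lerD// normrM normfV mulrC ler_pdivrMr ?normr_gt0//.
    have := lipschitz_of_derive t (t + h) (dphi k) (psiM k).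
    by have -> : t + h - t = h by ring.
  - move=> k; have D0 : D h k @[h --> 0^'] --> (0 : R).
      suff dk : h^-1 * (phi k (t + h) - phi k t) @[h --> 0^'] --> psi k t.
        by have := cvgB dk (cvg_cst (psi k t)); rewrite subrr; apply.
      have [dk <-] := dphi k t; move: dk; rewrite /derivable /derive.
      rewrite (_ : (fun h : R => h^-1 *: ((phi k \o shift t) (h *: 1) - phi k t))
        = (fun h => h^-1 * (phi k (t + h) - phi k t))); first by [].
      by apply/funext => h; rewrite /GRing.scale/= mulr1 (addrC h).
    rewrite [X in X @ _](_ : _ = (fun h => sobolev_term q w k * (D h k * D h k))).
      by have := cvgM (cvg_cst (sobolev_term q w k)) (cvgM D0 D0); rewrite !mulr0; apply.
    by apply/funext => h; rewrite termE expr2.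
  - by move=> A; rewrite -mulr_sumr ler_wpM2l.
by apply/funext => h; congr sobolev_norm; apply/funext => k; exact: DE.
Unshelve. all: by end_near. Qed.

(** * Families of oscillators *)

Lemma scalar_familyM (R : realType) (n : nat) (c : 'cV[int]_n -> R)
    (phi : 'cV[int]_n -> R -> R) (w : fourier_coefs R n) :
  scalar_family (fun k t => c k * phi k t) w
  = scalar_family phi (fun k => (c k)%:C *: w k).
Proof.
apply/funext => t; apply/funext => k.
by rewrite /scalar_family scalerA -rmorphM/= mulrC.
Qed.

Lemma sobolev_termZ (R : realType) (n : nat) (q : R) (c : 'cV[int]_n -> R)
    (w : fourier_coefs R n) k :
  sobolev_term q (fun k => (c k)%:C *: w k) k = c k ^+ 2 * sobolev_term q w k.
Proof. by rewrite /sobolev_term sqnormCZ mulrCA. Qed.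

Lemma in_sobolevZ (R : realType) (n : nat) (q K : R) (c d : 'cV[int]_n -> R)
    (w : fourier_coefs R n) :
  (forall k, `|d k| <= K * `|c k|) ->
  in_sobolev q (fun k => (c k)%:C *: w k) ->
  in_sobolev q (fun k => (d k)%:C *: w k).
Proof.
move=> dc; apply: (@in_sobolev_dom _ _ _ _ (K ^+ 2)) => [|k]; first exact: sqr_ge0.
rewrite !sobolev_termZ mulrA ler_wpM2r ?sobolev_term_ge0// -exprMn.
rewrite -[leLHS]real_normK ?num_real// -[leRHS]real_normK ?num_real//.
by rewrite lerXn2r// ?nnegrE// normrM (le_trans (dc k))// ler_wpM2r// ler_norm.
Qed.

Lemma in_sobolev_exp0 (R : realType) (n : nat) (q : R) (om : 'cV[int]_n -> R)
    (w : fourier_coefs R n) :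
  in_sobolev q (fun k => (om k ^+ 0)%:C *: w k) <-> in_sobolev q w.
Proof.
suff -> : (fun k => (om k ^+ 0)%:C *: w k) = w by [].
by apply/funext => k; rewrite expr0 scale1r.
Qed.

(** Each factor [om k] costs kappa derivatives. *)
Lemma in_sobolev_growth (R : realType) (n j : nat) (q s C kappa : R)
    (om : 'cV[int]_n -> R) (w : fourier_coefs R n) :
  0 <= C ->
  (forall k, om k ^+ 2 <= C * (1 + sqnorm (int_vec R k)) `^ kappa) ->
  q + j%:R * kappa <= s -> in_sobolev s w ->
  in_sobolev q (fun k => (om k ^+ j)%:C *: w k).
Proof.
move=> C0 omC qs; apply: (@in_sobolev_dom _ _ _ _ (C ^+ j)) => [|k].
  exact: exprn_ge0.
have x1 : 1 <= 1 + sqnorm (int_vec R k) by rewrite lerDl sqnorm_ge0.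
have x0 : 0 < 1 + sqnorm (int_vec R k) by exact: lt_le_trans x1.
rewrite sobolev_termZ /sobolev_term !mulrA ler_wpM2r ?sqnormC_ge0//.
apply: (@le_trans _ _ (C ^+ j * (1 + sqnorm (int_vec R k)) `^ (j%:R * kappa)
                      * (1 + sqnorm (int_vec R k)) `^ q)).
  rewrite ler_wpM2r ?powR_ge0// -exprM mulnC exprM.
  rewrite [j%:R * _]mulrC powRrM powR_mulrn ?powR_ge0// -exprMn.
  by rewrite lerXn2r// ?nnegrE ?sqr_ge0// mulr_ge0// powR_ge0.
rewrite -mulrA ler_wpM2l ?exprn_ge0// -powRD ?(gt_eqF x0) ?implybT//.
by rewrite ler_powR// addrC.
Qed.

Lemma in_sobolev_bounded (R : realType) (n : nat) (q K t : R)
    (phi : 'cV[int]_n -> R -> R) (w : fourier_coefs R n) :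
  (forall k, `|phi k t| <= K) -> in_sobolev q w ->
  in_sobolev q (scalar_family phi w t).
Proof.
move=> phiK wq; apply: (@in_sobolevZ _ _ _ K (fun=> 1)) => [k|].
  by rewrite normr1 mulr1.
by rewrite (_ : (fun k => _) = w)//; apply/funext => k; rewrite scale1r.
Qed.

Lemma norm_cos_le1 (R : realType) (x : R) : `|cos x| <= 1.
Proof. by rewrite ler_norml cos_geN1 cos_le1. Qed.

Lemma norm_sin_le1 (R : realType) (x : R) : `|sin x| <= 1.
Proof. by rewrite ler_norml sin_geN1 sin_le1. Qed.

(** The cosine and the sine are treated together because differentiation
    exchanges them, replacing [w] by [- om w] or [om w]. *)
Lemma sobolev_Cp_trig (R : realType) (n p : nat) (q : R) (om : 'cV[int]_n -> R)
    (w : fourier_coefs R n) :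
  (forall j, (j <= p)%N -> in_sobolev q (fun k => (om k ^+ j)%:C *: w k)) ->
  sobolev_Cp p q (scalar_family (fun k t => cos (om k * t)) w) /\
  sobolev_Cp p q (scalar_family (fun k t => sin (om k * t)) w).
Proof.
elim: p w => [|p IH] w hw.
  have wq : in_sobolev q w := (in_sobolev_exp0 q om w).1 (hw 0%N isT).
  split; split=> // t _; apply: in_sobolev_bounded wq => k.
    exact: norm_cos_le1.
  exact: norm_sin_le1.
have wq : in_sobolev q w := (in_sobolev_exp0 q om w).1 (hw 0%N isT).
have hw' (c : R) : `|c| = 1 -> forall j, (j <= p)%N ->
    in_sobolev q (fun k => (om k ^+ j)%:C *: ((c * om k)%:C *: w k)).
  move=> c1 j jp; rewrite (_ : (fun k => _) =
    (fun k => (om k ^+ j * (c * om k))%:C *: w k)).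
    apply: (@in_sobolevZ _ _ _ 1 (fun k => om k ^+ j.+1)) (hw _ _) => // k.
    by rewrite mul1r exprSr !normrM c1 mul1r.
  by apply/funext => k; rewrite scalerA -rmorphM.
have absom : in_sobolev q (fun k => `|om k|%:C *: w k).
  apply: (@in_sobolevZ _ _ _ 1 (fun k => om k ^+ 1)) (hw _ _) => // k.
  by rewrite mul1r expr1 normr_id.
split; split.
- by move=> t _; apply: in_sobolev_bounded wq => k; exact: norm_cos_le1.
- exists (scalar_family (fun k t => (- 1 * om k) * sin (om k * t)) w); split.
    move=> t _; apply: (@sobolev_deriv_scalar _ _ _ _ _ _ (fun k => `|om k|)) => //.
      by move=> k x; apply: is_derive_eq; rewrite /GRing.scale/=; ring.
    move=> k x; rewrite normrM normrM normrN1 mul1r ler_piMr//; exact: norm_sin_le1.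
  rewrite scalar_familyM; apply: (IH _ _).2; apply: hw'.
  by rewrite normrN1.
- by move=> t _; apply: in_sobolev_bounded wq => k; exact: norm_sin_le1.
exists (scalar_family (fun k t => (1 * om k) * cos (om k * t)) w); split.
  move=> t _; apply: (@sobolev_deriv_scalar _ _ _ _ _ _ (fun k => `|om k|)) => //.
    by move=> k x; apply: is_derive_eq; rewrite /GRing.scale/=; ring.
  move=> k x; rewrite normrM normrM normr1 mul1r ler_piMr//; exact: norm_cos_le1.
rewrite scalar_familyM; apply: (IH _ _).1; apply: hw'.
by rewrite normr1.
Qed.

(** The solution of y'' + om^2 y = 0 with y(0) = 0 and y'(0) = 1. *)
Definition sin_propagator (R : realType) (om t : R) : R :=
  if om == 0 then t else sin (om * t) / om.

Lemma is_derive_sin_propagator (R : realType) (om t : R) :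
  is_derive t 1 (sin_propagator om) (cos (om * t)).
Proof.
rewrite /sin_propagator; have [->|om0] := eqVneq om 0.
  by rewrite mul0r cos0; exact: is_derive_id.
apply: is_derive_eq; rewrite /GRing.scale/=.
by field.
Qed.

Lemma norm_sin_propagator_le (R : realType) (om t : R) :
  `|sin_propagator om t| <= `|t|.
Proof.
have sp0 : sin_propagator om 0 = 0.
  by rewrite /sin_propagator; case: eqP => // _; rewrite mulr0 sin0 mul0r.
have := @lipschitz_of_derive _ (sin_propagator om) (fun t => cos (om * t)) 1 0 t.
rewrite sp0 !subr0 mul1r; apply.
  by move=> z; exact: is_derive_sin_propagator.
by move=> z; exact: norm_cos_le1.
Qed.

(** One factor [om] less than in [sobolev_Cp_trig]: the first derivative is a
    cosine with the same amplitude. *)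
Lemma sobolev_Cp_sin_propagator (R : realType) (n p : nat) (q : R)
    (om : 'cV[int]_n -> R) (w : fourier_coefs R n) :
  in_sobolev q w ->
  (forall j, (j < p)%N -> in_sobolev q (fun k => (om k ^+ j)%:C *: w k)) ->
  sobolev_Cp p q (scalar_family (fun k => sin_propagator (om k)) w).
Proof.
move=> wq hw.
have inq t : in_sobolev q (scalar_family (fun k => sin_propagator (om k)) w t).
  by apply: in_sobolev_bounded wq => k; exact: norm_sin_propagator_le.
case: p hw => [|p] hw; split=> //.
exists (scalar_family (fun k t => cos (om k * t)) w); split; last first.
  exact: (sobolev_Cp_trig hw).1.
move=> t _; apply: (@sobolev_deriv_scalar _ _ _ _ _ _ (fun k => om k ^+ 0)).
- by move=> k x; exact: is_derive_sin_propagator.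
- by move=> k x; exact: norm_cos_le1.
- exact: hw.
Qed.

Definition line_part (R : realType) (n : nat) (w : fourier_coefs R n) :
    fourier_coefs R n :=
  fun k => complex_mx (line_proj (int_vec R k)) *m w k.

Definition orth_part (R : realType) (n : nat) (w : fourier_coefs R n) :
    fourier_coefs R n :=
  fun k => w k - line_part w k.

(** Pythagoras: the squared norm of y minus its projection is nonnegative. *)
Lemma sqnorm_line_proj_le (R : realType) (n : nat) (v y : 'cV[R]_n) :
  sqnorm (line_proj v *m y) <= sqnorm y.
Proof.
pose d := \sum_(i < n) v i 0 * y i 0.
pose s := sqnorm v; pose c := d / s.
have PE : line_proj v *m y = c *: v.
  rewrite /line_proj -scalemxAl -mulmxA.
  have -> : v^T *m y = d%:M.
    apply/matrixP => i j; rewrite !ord1 !mxE eqxx mulr1n.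
    by apply: eq_bigr => l _; rewrite mxE.
  by rewrite mul_mx_scalar scalerA mulrC.
have cs : c ^+ 2 * s = c * d.
  rewrite /c; have [->|s0] := eqVneq s 0; first by rewrite invr0 !mulr0 mul0r.
  by field.
have nE : sqnorm (c *: v) = c ^+ 2 * s.
  by rewrite /sqnorm mulr_sumr; apply: eq_bigr => i _; rewrite mxE exprMn.
have : 0 <= sqnorm (y - c *: v) by apply: sumr_ge0 => i _; exact: sqr_ge0.
have -> : sqnorm (y - c *: v) = sqnorm y - 2 * (c * d) + c ^+ 2 * s.
  rewrite /s /sqnorm /d !mulr_sumr -sumrB -big_split/=; apply: eq_bigr => i _.
  by rewrite !mxE; ring.
rewrite PE nE cs; lra.
Qed.

(** A real matrix acts separately on the real and the imaginary part. *)
Lemma sqnormC_line_proj_le (R : realType) (n : nat) (v : 'cV[R]_n)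
    (w : 'cV[R[i]]_n) :
  sqnormC (complex_mx (line_proj v) *m w) <= sqnormC w.
Proof.
pose re := map_mx (@complex.Re R) w; pose im := map_mx (@complex.Im R) w.
have nE (u : 'cV[R[i]]_n) : sqnormC u =
    sqnorm (map_mx (@complex.Re R) u) + sqnorm (map_mx (@complex.Im R) u).
  by rewrite /sqnormC big_split/=; congr (_ + _); apply: eq_bigr => i _; rewrite mxE.
have reE (A : 'M[R]_n) : map_mx (@complex.Re R) (complex_mx A *m w) = A *m re.
  apply/matrixP => i j; rewrite !mxE raddf_sum; apply: eq_bigr => l _.
  by rewrite !mxE; case: (w l j) => x y /=; ring.
have imE (A : 'M[R]_n) : map_mx (@complex.Im R) (complex_mx A *m w) = A *m im.
  apply/matrixP => i j; rewrite !mxE raddf_sum; apply: eq_bigr => l _.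
  by rewrite !mxE; case: (w l j) => x y /=; ring.
by rewrite (nE w) nE reE imE lerD// sqnorm_line_proj_le.
Qed.

Lemma in_sobolev_line_part (R : realType) (n : nat) (q : R) (w : fourier_coefs R n) :
  in_sobolev q w -> in_sobolev q (line_part w).
Proof.
apply: (@in_sobolev_dom _ _ _ _ 1) => // k.
by rewrite mul1r ler_wpM2l ?powR_ge0// sqnormC_line_proj_le.
Qed.

Lemma in_sobolev_orth_part (R : realType) (n : nat) (q : R) (w : fourier_coefs R n) :
  in_sobolev q w -> in_sobolev q (orth_part w).
Proof.
move=> wq; have := in_sobolevD wq (in_sobolev_line_part
  (in_sobolev_bounded (phi := fun _ _ => -1) (K := 1) (t := 0) _ wq)).
rewrite (_ : (fun k => _) = orth_part w); first by apply=> k; rewrite normrN1.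
apply/funext => k; rewrite /orth_part /line_part /scalar_family.
by rewrite -scalemxAr rmorphN1 scaleN1r.
Qed.

(** * Decomposition and regularity of the solution *)

Lemma two_eigen_mxM (R : realType) (n : nat) (v : 'cV[R]_n) (a b c d : R) :
  v != 0 -> two_eigen_mx v a b *m two_eigen_mx v c d = two_eigen_mx v (a * c) (b * d).
Proof.
move=> /line_proj_idem; rewrite /two_eigen_mx; move: (line_proj v) => P PP.
rewrite mulmxDl !mulmxDr -!scalemxAl -!scalemxAr !mulmxBl !mulmxBr.
by rewrite mulmx1 mul1mx mulmx1 PP subrr !scaler0 subr0 addr0 add0r !scalerA.
Qed.

Lemma two_eigen_mx1 (R : realType) (n : nat) (v : 'cV[R]_n) :
  two_eigen_mx v 1 1 = 1%:M.
Proof. by rewrite /two_eigen_mx !scale1r addrC subrK. Qed.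

Lemma invmx_two_eigen_mx (R : realType) (n : nat) (v : 'cV[R]_n) (a b : R) :
  v != 0 -> a != 0 -> b != 0 ->
  invmx (two_eigen_mx v a b) = two_eigen_mx v a^-1 b^-1.
Proof.
move=> v0 a0 b0.
have AB : two_eigen_mx v a b *m two_eigen_mx v a^-1 b^-1 = 1%:M.
  by rewrite two_eigen_mxM// !mulfV// two_eigen_mx1.
have [Au _] := mulmx1_unit AB.
by rewrite -[RHS](mulKmx Au) AB mulmx1.
Qed.

Lemma complex_two_eigen_mx (R : realType) (n : nat) (v : 'cV[R]_n) (a b : R)
    (w : 'cV[R[i]]_n) :
  complex_mx (two_eigen_mx v a b) *m w =
  a%:C *: (complex_mx (line_proj v) *m w)
  + b%:C *: (w - complex_mx (line_proj v) *m w).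
Proof.
have -> : complex_mx (two_eigen_mx v a b) =
    a%:C *: complex_mx (line_proj v) + b%:C *: (1%:M - complex_mx (line_proj v)).
  rewrite /two_eigen_mx; move: (line_proj v) => P; apply/matrixP => i j.
  by rewrite !mxE rmorphD/= !rmorphM/= rmorphB/= rmorph_nat.
by rewrite mulmxDl -!scalemxAl mulmxBl mul1mx.
Qed.

Lemma line_proj0 (R : realType) (n : nat) : line_proj (0 : 'cV[R]_n) = 0.
Proof. by rewrite /line_proj mul0mx scaler0. Qed.

Lemma int_vec0 (R : realType) (n : nat) : int_vec R (0 : 'cV[int]_n) = 0.
Proof. by apply/matrixP => i j; rewrite !mxE. Qed.

Lemma sqnorm0 (R : realType) (n : nat) : sqnorm (0 : 'cV[R]_n) = 0.
Proof. by apply/eqP; rewrite sqnorm_eq0. Qed.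

Lemma lambda1_0 (R : realType) (n : nat) (delta beta mu lam : R) :
  lambda1 delta beta mu lam (0 : 'cV[R]_n) = 0.
Proof. by rewrite /lambda1 sqnorm0 oppr0 mul0r. Qed.

Lemma lambda2_0 (R : realType) (n : nat) (delta beta mu : R) :
  lambda2 delta beta mu (0 : 'cV[R]_n) = 0.
Proof. by rewrite /lambda2 sqnorm0 mulr0 mul0r. Qed.

(** At k = 0 both eigenvalues and the projection vanish ([line_proj0] holds
    because 0^-1 = 0), so that the mode f_0 + t g_0 is the instance om = 0 of
    the general formula. *)
Lemma solutionE (R : realType) (n : nat) (delta beta mu lam : R)
    (f g : fourier_coefs R n)
    (lambda1_lt0 : forall nu : 'cV[R]_n, nu != 0 ->
      lambda1 delta beta mu lam nu < 0)
    (lambda2_lt0 : forall nu : 'cV[R]_n, nu != 0 ->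
      lambda2 delta beta mu nu < 0) :
  let om1 (k : 'cV[int]_n) := Num.sqrt (- lambda1 delta beta mu lam (int_vec R k)) in
  let om2 (k : 'cV[int]_n) := Num.sqrt (- lambda2 delta beta mu (int_vec R k)) in
  solution delta beta mu lam f g = fun t k =>
    (scalar_family (fun k t => cos (om1 k * t)) (line_part f) t k
     + scalar_family (fun k t => cos (om2 k * t)) (orth_part f) t k)
    + (scalar_family (fun k => sin_propagator (om1 k)) (line_part g) t k
     + scalar_family (fun k => sin_propagator (om2 k)) (orth_part g) t k).
Proof.
move=> om1 om2; apply/funext => t; apply/funext => k.
rewrite /solution /scalar_family /orth_part /line_part.
have [->|k0] := eqVneq k 0.
  rewrite /om1 /om2 int_vec0 lambda1_0 lambda2_0 oppr0 sqrtr0 line_proj0.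
  have -> : complex_mx (0 : 'M[R]_n) = 0 by apply/matrixP => i j; rewrite !mxE.
  rewrite !mul0mx !scaler0 !subr0 !add0r /sin_propagator eqxx mul0r cos0.
  by rewrite scale1r.
have v0 := int_vec_neq0 R k0.
have o1 : om1 k != 0 by rewrite gt_eqF// sqrtr_gt0 oppr_gt0 lambda1_lt0.
have o2 : om2 k != 0 by rewrite gt_eqF// sqrtr_gt0 oppr_gt0 lambda2_lt0.
rewrite /multiplier_fun invmx_two_eigen_mx// two_eigen_mxM//.
by rewrite !complex_two_eigen_mx /sin_propagator (negbTE o1) (negbTE o2).
Qed.

(** The conditions on [s2] bound [q + j * kappa] for j < p, and [q] itself when
    p = 0. *)
Lemma solution_Cp (R : realType) (n p : nat) (delta beta mu lam q s1 s2 C kappa : R)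
    (f g : fourier_coefs R n)
    (lambda1_lt0 : forall nu : 'cV[R]_n, nu != 0 ->
      lambda1 delta beta mu lam nu < 0)
    (lambda2_lt0 : forall nu : 'cV[R]_n, nu != 0 ->
      lambda2 delta beta mu nu < 0) :
  0 <= C -> 0 <= kappa ->
  (forall k : 'cV[int]_n, k != 0 ->
    `|lambda1 delta beta mu lam (int_vec R k)|
       <= C * (1 + sqnorm (int_vec R k)) `^ kappa /\
    `|lambda2 delta beta mu (int_vec R k)|
       <= C * (1 + sqnorm (int_vec R k)) `^ kappa) ->
  in_sobolev s1 f -> in_sobolev s2 g ->
  q + p%:R * kappa <= s1 -> q <= s2 -> q + p%:R * kappa <= s2 + kappa ->
  sobolev_Cp p q (solution delta beta mu lam f g).
Proof.
move=> C0 kappa0 growth fs gs qs1 qs2 qs2'.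
pose om1 (k : 'cV[int]_n) := Num.sqrt (- lambda1 delta beta mu lam (int_vec R k)).
pose om2 (k : 'cV[int]_n) := Num.sqrt (- lambda2 delta beta mu (int_vec R k)).
rewrite solutionE// -/om1 -/om2.
have om1C k : om1 k ^+ 2 <= C * (1 + sqnorm (int_vec R k)) `^ kappa.
  have [->|k0] := eqVneq k 0.
    by rewrite /om1 int_vec0 lambda1_0 oppr0 sqrtr0 expr0n mulr_ge0// powR_ge0.
  have l0 : 0 <= - lambda1 delta beta mu lam (int_vec R k).
    by rewrite oppr_ge0 ltW// lambda1_lt0// int_vec_neq0.
  by rewrite sqr_sqrtr// (le_trans _ (growth k k0).1)// -normrN ler_norm.
have om2C k : om2 k ^+ 2 <= C * (1 + sqnorm (int_vec R k)) `^ kappa.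
  have [->|k0] := eqVneq k 0.
    by rewrite /om2 int_vec0 lambda2_0 oppr0 sqrtr0 expr0n mulr_ge0// powR_ge0.
  have l0 : 0 <= - lambda2 delta beta mu (int_vec R k).
    by rewrite oppr_ge0 ltW// lambda2_lt0// int_vec_neq0.
  by rewrite sqr_sqrtr// (le_trans _ (growth k k0).2)// -normrN ler_norm.
have fj j : (j <= p)%N -> q + j%:R * kappa <= s1.
  by move=> jp; rewrite (le_trans _ qs1)// lerD2l ler_wpM2r// ler_nat.
have gj j : (j < p)%N -> q + j%:R * kappa <= s2.
  move=> jp; rewrite -(lerD2r kappa) (le_trans _ qs2')// -addrA lerD2l.
  by rewrite -{2}[kappa]mul1r -mulrDl natr1 ler_wpM2r// ler_nat.
have gq (w : fourier_coefs R n) : in_sobolev s2 w -> in_sobolev q w.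
  move=> ws; apply: (in_sobolev_exp0 q om1 w).1.
  by apply: (in_sobolev_growth C0 om1C _ ws); rewrite mul0r addr0.
have lf := in_sobolev_line_part fs; have of_ := in_sobolev_orth_part fs.
have lg := in_sobolev_line_part gs; have og := in_sobolev_orth_part gs.
apply: sobolev_CpD; apply: sobolev_CpD.
- apply: (sobolev_Cp_trig _).1 => j jp.
  exact: (in_sobolev_growth C0 om1C (fj j jp) lf).
- apply: (sobolev_Cp_trig _).1 => j jp.
  exact: (in_sobolev_growth C0 om2C (fj j jp) of_).
- apply: sobolev_Cp_sin_propagator; first exact: gq.
  by move=> j jp; exact: (in_sobolev_growth C0 om1C (gj j jp) lg).
- apply: sobolev_Cp_sin_propagator; first exact: gq.
  by move=> j jp; exact: (in_sobolev_growth C0 om2C (gj j jp) og).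
Qed.

Theorem theorem17 (R : realType) (n : nat) (delta beta mu lam : R)
    (s1 s2 : R) (f g : fourier_coefs R n)
    (n_ge1 : (1 <= n)%N) (delta_gt0 : 0 < delta) (beta_lt : beta < n%:R + 2)
    (mu_gt0 : 0 < mu)
    (lambda1_lt0 : forall nu : 'cV[R]_n, nu != 0 ->
      lambda1 delta beta mu lam nu < 0)
    (lambda2_lt0 : forall nu : 'cV[R]_n, nu != 0 ->
      lambda2 delta beta mu nu < 0)
    (f_sobolev : in_sobolev s1 f) (g_sobolev : in_sobolev s2 g) :
  let s := Num.min s1 (s2 + Num.max 0 ((beta - n%:R) / 2)) in
  let U := solution delta beta mu lam f g in
  [/\ beta < n%:R -> forall q : R, q <= s -> sobolev_Cinfty q U,
      beta = n%:R -> forall q : R, q < s -> sobolev_Cinfty q U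
    & n%:R < beta -> forall (q : R) (p : nat), (0 < p)%N ->
        q - s1 + p.+1%:R * ((beta - n%:R) / 2) <= 0 ->
        q - s2 + p%:R * ((beta - n%:R) / 2) <= 0 ->
        sobolev_Cp p.+1 q U].
Proof.
move=> s U; pose a : R := (n%:R + 2 - beta) / 2.
have a0 : 0 < a by rewrite divr_gt0// subr_gt0.
have growth (r : R) : 0 < r -> r <= 1 -> r != a ->
  exists2 C : R, 0 <= C & forall k : 'cV[int]_n, k != 0 ->
    `|lambda1 delta beta mu lam (int_vec R k)|
       <= C * (1 + sqnorm (int_vec R k)) `^ (1 - Num.min a r) /\
    `|lambda2 delta beta mu (int_vec R k)|
       <= C * (1 + sqnorm (int_vec R k)) `^ (1 - Num.min a r).
  exact: eigenvalue_growth.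
split.
- move=> beta_lt_n q; rewrite /s max_l; last by rewrite ler_pdivrMr// mul0r subr_le0 ltW.
  rewrite addr0 le_min => /andP[qs1 qs2] p.
  have a1 : 1 < a by rewrite /a; lra.
  have a1' : 1 != a by rewrite lt_eqF.
  have [C C0 hC] := growth 1 ltr01 (lexx _) a1'.
  rewrite (min_r (ltW a1)) subrr in hC.
  apply: (solution_Cp lambda1_lt0 lambda2_lt0 C0 (lexx 0) hC f_sobolev g_sobolev);
    by rewrite ?mulr0 ?addr0.
- move=> beta_n q; rewrite /s beta_n subrr mul0r max_l// addr0 lt_min => /andP[qs1 qs2] p.
  have a1 : a = 1 by rewrite /a beta_n; field.
  pose d := Num.min (s1 - q) (s2 - q).
  have d0 : 0 < d by rewrite lt_min !subr_gt0 qs1.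
  (* an exponent kappa < 1 with p kappa <= d *)
  pose kappa := d / (p%:R + 1 + d).
  have den0 : 0 < p%:R + 1 + d by rewrite addr_gt0// ltr_wpDl.
  have kappa0 : 0 < kappa by rewrite divr_gt0.
  have kappa1 : kappa < 1 by rewrite ltr_pdivrMr// mul1r ltrDr ltr_wpDl.
  have pkd : p%:R * kappa <= d.
    rewrite mulrA ler_pdivrMr// mulrC ler_wpM2l ?(ltW d0)//.
    by rewrite -addrA lerDl addr_ge0// ltW.
  have [||| C C0 hC] := growth (1 - kappa).
  - by rewrite subr_gt0.
  - by rewrite lerBlDr lerDl ltW.
  - by rewrite a1 lt_eqF// ltrBlDr ltrDl.
  have kE : 1 - Num.min a (1 - kappa) = kappa.
    by rewrite a1 min_r ?subKr// lerBlDr lerDl ltW.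
  rewrite kE in hC.
  have ds1 : d <= s1 - q by rewrite ge_min lexx.
  have ds2 : d <= s2 - q by rewrite ge_min lexx orbT.
  apply: (solution_Cp lambda1_lt0 lambda2_lt0 C0 (ltW kappa0) hC f_sobolev
    g_sobolev); lra.
- move=> n_lt_beta q p p0 h1 h2; pose kappa := (beta - n%:R) / 2.
  have kappa0 : 0 < kappa by rewrite divr_gt0// subr_gt0.
  have aE : a = 1 - kappa by rewrite /a /kappa; field.
  have a1 : a < 1 by rewrite aE; lra.
  have a1' : 1 != a by rewrite gt_eqF.
  have [C C0 hC] := growth 1 ltr01 (lexx _) a1'.
  rewrite (min_l (ltW a1)) aE subKr in hC.
  rewrite -/kappa in h1 h2.
  have pk : 0 <= p%:R * kappa by rewrite mulr_ge0// ltW.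
  have pS : p.+1%:R * kappa = p%:R * kappa + kappa by rewrite -natr1; ring.
  apply: (solution_Cp lambda1_lt0 lambda2_lt0 C0 (ltW kappa0) hC f_sobolev g_sobolev);
    rewrite ?pS; lra.
Qed.
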